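(* Let $f\in L^2(0,1)$ and let $g$ be its Abel transform, $g(x)=\int_0^x \frac{f(y)}{\sqrt{x-y}}\,dy$ for $0\leqslant x\leqslant 1$. Let $\eta:\mathbb{R}\to\mathbb{C}$ be the $2\pi$-periodic function whose restriction to $[-\pi,\pi)$ is $$\eta(t)=\frac{\operatorname{sgn}(t)}{2\pi i}\,e^{it/2}\,g\!\left(\sin^2\tfrac{t}{2}\right),\qquad t\in[-\pi,\pi),$$ and set $\hat\gamma_n=\int_{-\pi}^{\pi}\eta(t)\,e^{int}\,dt$ for integers $n\geqslant 0$. Then $$f(x)=\sum_{n=0}^{\infty}c_n\,\overline{P}_n(x)\qquad\text{(convergence in } L^2(0,1)),\qquad\text{with } c_n=(-1)^n\sqrt{2n+1}\;\hat\gamma_n ;$$ that is, the shifted Legendre coefficients $c_n=\int_0^1 f(x)\overline{P}_n(x)\,dx$ of $f$ satisfy $$\frac{(-1)^n}{\sqrt{2n+1}}\,c_n=\int_{-\pi}^{\pi}\eta(t)\,e^{int}\,dt\qquad\text{for all } n\geqslant 0.$$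
   Context: $\overline{P}_n(x)=\sqrt{2n+1}\,P_n(2x-1)$ denotes the shifted (normalized) Legendre polynomial, where $P_n$ is the ordinary Legendre polynomial, given by $\sum_{n\geqslant 0}P_n(x)t^n=(1-2xt+t^2)^{-1/2}$. The family $\{\overline{P}_n\}_{n\geqslant0}$ is a complete orthonormal basis of $L^2(0,1)$. $\operatorname{sgn}$ is the sign function. Functions are identified when they agree almost everywhere. *)

(* Defs.v *)
From HB Require Import structures.
From mathcomp Require Import all_boot all_order all_algebra.
From mathcomp Require Import all_classical all_reals all_analysis.
From mathcomp Require Import complex.

Set Implicit Arguments.
Unset Strict Implicit.
Unset Printing Implicit Defensive.

Import Order.TTheory GRing.Theory Num.Theory.
Import numFieldNormedType.Exports.

Local Open Scope classical_set_scope.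
Local Open Scope ring_scope.
Local Open Scope complex_scope.

(* The library has no integration theory for functions with values in [R[i]]:
   integrability and the integral, with respect to Lebesgue measure, are taken
   componentwise.  [Rintegral] is total, so the value of [cintegral] is
   meaningful only under [cintegrable]. *)
Definition cintegrable (R : realType) (D : set R) (h : R -> R[i]) : Prop :=
  (@lebesgue_measure R).-integrable D (fun x => (complex.Re (h x))%:E) /\
  (@lebesgue_measure R).-integrable D (fun x => (complex.Im (h x))%:E).

Definition cintegral (R : realType) (D : set R) (h : R -> R[i]) : R[i] :=
  (Rintegral (@lebesgue_measure R) D (fun x => complex.Re (h x))) +i*
  (Rintegral (@lebesgue_measure R) D (fun x => complex.Im (h x))).

Definition sqnormL2 (R : realType) (h : R -> R[i]) : \bar R :=
  (\int[@lebesgue_measure R]_(x in `]0%R, 1%R[)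
    (complex.Re (h x) ^+ 2 + complex.Im (h x) ^+ 2)%:E)%E.

(* An element of the complex space L^2(0,1) is given by a representative;
   its values outside ]0, 1[ are irrelevant. *)
Definition inL2 (R : realType) (h : R -> R[i]) : Prop :=
  [/\ measurable_fun (`]0, 1[ : set R) (fun x => complex.Re (h x)),
      measurable_fun (`]0, 1[ : set R) (fun x => complex.Im (h x)) &
      (sqnormL2 h < +oo)%E].

Definition cvgL2 (R : realType) (u : nat -> R -> R[i]) (h : R -> R[i]) : Prop :=
  sqnormL2 (fun x => h x - u N x) @[N --> \oo] --> 0%E.

Definition expi (R : realType) (t : R) : R[i] := cos t +i* sin t.

(* The generating function is an identity of power series in [t]; for a fixed
   real [x] it holds for [t] in a neighbourhood of 0 depending on [x], which
   determines every coefficient [(P n).[x]], hence the polynomials [P n]. *)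
Definition is_legendre (R : realType) (P : nat -> {poly R}) : Prop :=
  forall x : R, \forall t \near (0 : R),
    series (fun n => (P n).[x] * t ^+ n) @ \oo -->
      (1 - 2 * x * t + t ^+ 2) `^ (- 2^-1).

Definition shifted_legendre (R : realType) (P : nat -> {poly R}) (n : nat)
    (x : R) : R :=
  Num.sqrt (2 * n + 1)%N%:R * (P n).[2 * x - 1].

Definition abel_integrand (R : realType) (f : R -> R[i]) (x y : R) : R[i] :=
  f y / (Num.sqrt (x - y))%:C.

(* For [f] in L^2(0,1) the integral converges for almost every [x] only. *)
Definition abel (R : realType) (f : R -> R[i]) (x : R) : R[i] :=
  cintegral `]0, x[ (abel_integrand f x).

Definition legendre_coef (R : realType) (P : nat -> {poly R}) (f : R -> R[i])
    (n : nat) : R[i] :=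
  cintegral `]0, 1[ (fun x => f x * (shifted_legendre P n x)%:C).

Definition gamma_hat (R : realType) (eta : R -> R[i]) (n : nat) : R[i] :=
  cintegral `[- pi, pi] (fun t => eta t * expi (n%:R * t)).

(* Main.v *)
Require Import Defs.
From mathcomp Require Import all_boot all_order all_algebra.
From mathcomp Require Import all_classical all_reals all_analysis.
From mathcomp Require Import measurable_realfun.
From mathcomp Require Import complex.
From mathcomp Require Import ring lra zify.

(** Write [g] for the Abel transform of [f] and [beta = n + 1/2].  The half
    phase in [eta] combines with [e^(int)] into [e^(i beta t)], and [sgn t / i]
    makes the sine part even and the cosine part odd.  Folding [[- pi, pi]] onto
    [[0, pi]] therefore leaves
      [gamma_hat eta n = 1/pi * int_0^pi g(sin^2(t/2)) sin(beta t) dt],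
    and exchanging the two integrations turns this into [int_0^1 f(y) K_n(y) dy]
    with
      [K_n(y) = 1/pi * int sin(beta t) / sqrt(sin^2(t/2) - y) dt]
    over the [t] in [[0, pi]] such that [sin^2(t/2) > y].  This is the
    Mehler-Dirichlet integral, whose value is [P_n(1 - 2y) = (-1)^n P_n(2y - 1)]
    ([integral_sin_abel_kernel]); hence the formula for the coefficients.

    The Mehler-Dirichlet integral is computed rather than quoted.  The quotient
    [sin(beta t) / sin(t/2)] is a polynomial in [cos^2(t/2)] with explicit
    coefficients ([sin_half_dirichlet]), and each power of [cos^2(t/2)] has an
    explicit integral against [sin(t/2) / sqrt(sin^2(t/2) - y)]
    ([abel_kernel_moment]).  The result is the polynomial [slegendre n] evaluated
    at [1 - y].  Since the polynomials [P n] are only known through their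
    generating function, they are identified with [slegendre n] by means of the
    three-term recurrence: for [P] it comes from the differential equation of
    the generating function ([is_legendre_rec]), for [slegendre] from binomial
    identities ([slegendre_rec]).

    Fubini's theorem needs the double integral to be absolutely convergent.  With
    [s = sin(t/2)], the weight [|f(y)|] is at most [s f(y)^2 + 1/s]; the first
    term is integrated in [t] first and gives [pi f(y)^2], the second is
    integrated in [y] first and gives the constant [2]
    ([integrable_abel_weight]).

    Finally the convergence in [L^2] is the completeness of the Legendre
    polynomials ([legendre_sum_cvg]).  They are orthogonal because they are
    eigenfunctions of a symmetric differential operator, their norms follow from
    the recurrence, and polynomials are dense in [L^2(0,1)]
    ([poly_approx_L2]). *)

Set Implicit Arguments.
Unset Strict Implicit.
Unset Printing Implicit Defensive.

Import Order.TTheory GRing.Theory Num.Theory.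
Import numFieldNormedType.Exports.
Local Open Scope classical_set_scope.
Local Open Scope ring_scope.

(** * Explicit shifted Legendre polynomials and the Dirichlet kernel *)

(** The coefficient of [X ^ k] in the polynomial which, at [(2 cos a)^2], takes
    the value [sin ((2n + 1) a) / sin a] of the Dirichlet kernel. *)
Definition dirichlet_coef (R : numFieldType) (n k : nat) : R :=
  (- 1) ^+ (n + k) * 'C(n + k, k.*2)%:R.

Lemma dirichlet_coef_rec (R : numFieldType) (n k : nat) :
  dirichlet_coef R n.+2 k.+1 = dirichlet_coef R n.+1 k
    - 2 * dirichlet_coef R n.+1 k.+1 - dirichlet_coef R n k.+1.
Proof.
rewrite /dirichlet_coef !addnS !addSn doubleS !binS !natrD !exprS; ring.
Qed.

Lemma dirichlet_coef_rec0 (R : numFieldType) (n : nat) :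
  dirichlet_coef R n.+2 0 = - 2 * dirichlet_coef R n.+1 0 - dirichlet_coef R n 0.
Proof. by rewrite /dirichlet_coef !addn0 !bin0 !exprS; ring. Qed.

Definition dirichlet_poly (R : numFieldType) (n : nat) : {poly R} :=
  \poly_(k < n.+1) dirichlet_coef R n k.

Lemma coef_dirichlet_poly (R : numFieldType) (n k : nat) :
  (dirichlet_poly R n)`_k = dirichlet_coef R n k.
Proof.
rewrite coef_poly ltnS; case: leqP => // nk.
by rewrite /dirichlet_coef bin_small ?mulr0// -addnn ltn_add2r.
Qed.

(** The factor [X - 2] is [2 cos (2a)] at [X = (2 cos a)^2]: this is the
    recurrence of [sin ((2n + 1) a)] in [n]. *)
Lemma dirichlet_poly_rec (R : numFieldType) (n : nat) :
  dirichlet_poly R n.+2 =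
    ('X - 2%:P) * dirichlet_poly R n.+1 - dirichlet_poly R n.
Proof.
apply/polyP => -[|k];
  rewrite coefB mulrBl coefB coefXM coefCM !coef_dirichlet_poly /=.
  by rewrite dirichlet_coef_rec0 sub0r mulNr.
by rewrite dirichlet_coef_rec.
Qed.

Lemma dirichlet_poly0 (R : numFieldType) : dirichlet_poly R 0 = 1.
Proof.
apply/polyP => k; rewrite coef_dirichlet_poly coef1 /dirichlet_coef add0n.
case: k => [|k]; first by rewrite expr0 mul1r.
rewrite bin_small ?mulr0 // -addnn; lia.
Qed.

Lemma dirichlet_poly1 (R : numFieldType) : dirichlet_poly R 1 = 'X - 1.
Proof.
apply/polyP => k; rewrite coef_dirichlet_poly coefB coefX coef1 /dirichlet_coef.
case: k => [|[|k]] /=.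
- by rewrite expr1 bin0 sub0r mulr1.
- by rewrite addn1 sqrrN expr1n binn subr0 mulr1.
- by rewrite bin_small ?mulr0 ?subr0// doubleS; lia.
Qed.

(** The central binomial coefficient is, up to a power of [4], the mean value of
    [sin^(2k)]; integrating the Dirichlet kernel against the Abel kernel
    multiplies its coefficients by these numbers.  Equivalently, this is
    [(-1)^(n+k) C(n,k) C(n+k,k)], the familiar coefficient of the shifted
    Legendre polynomial. *)
Definition slegendre_coef (R : numFieldType) (n k : nat) : R :=
  dirichlet_coef R n k * 'C(k.*2, k)%:R.

Lemma slegendre_coef_small (R : numFieldType) (n k : nat) : (n < k)%N ->
  slegendre_coef R n k = 0.
Proof.
by move=> nk; rewrite /slegendre_coef /dirichlet_coef bin_small ?mulr0 ?mul0r// -addnn ltn_add2r.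
Qed.

(** This relation and the next one determine all the coefficients from a single
    one.  Both are stated without division or truncated subtraction, so that they
    also hold beyond the degree, where both sides vanish. *)
Lemma slegendre_coef_recn (R : numFieldType) (n k : nat) :
  (n%:R + 1 - k%:R) * slegendre_coef R n.+1 k =
  - (n%:R + 1 + k%:R) * slegendre_coef R n k.
Proof.
have [kn|nk] := leqP k n.+1; last first.
  by rewrite !slegendre_coef_small ?mulr0// ltnW.
rewrite /slegendre_coef /dirichlet_coef.
have := mul_bin_down (n.+1 + k) k.*2.
have -> : (n.+1 + k - k.*2 = n.+1 - k)%N by rewrite -addnn; lia.
rewrite addSn /= => /(congr1 (fun m => m%:R : R)).
rewrite !natrM natrB// -!natr1 natrD => E.
rewrite exprS.
transitivity (- (-1) ^+ (n + k) * ((n%:R + 1 - k%:R) * ('C((n + k).+1, k.*2))%:R)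
   * 'C(k.*2, k)%:R : R); first ring.
by rewrite -E; ring.
Qed.

(** Read on coefficients, this is the Legendre differential equation. *)
Lemma slegendre_coef_reck (R : numFieldType) (n k : nat) :
  (k.+1%:R) ^+ 2 * slegendre_coef R n k.+1 =
  (k%:R * (k%:R + 1) - n%:R * (n%:R + 1)) * slegendre_coef R n k.
Proof.
have [kn|nk] := leqP k n; last first.
  by rewrite !slegendre_coef_small ?mulr0// ltnW.
rewrite /slegendre_coef /dirichlet_coef addnS.
have /(congr1 (fun m => m%:R : R)) E1 := mul_bin_down (n + k).+1 k.*2.
have /(congr1 (fun m => m%:R : R)) E2 := mul_bin_left (n + k).+1 k.*2.
have /(congr1 (fun m => m%:R : R)) E3 := mul_bin_left (n + k).+1 k.*2.+1.
have /(congr1 (fun m => m%:R : R)) E4 := mul_bin_diag k.*2.+1.+1 k.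
have /(congr1 (fun m => m%:R : R)) E5 := mul_bin_down k.*2.+1 k.
move: E1 E2 E3 E4 E5; rewrite /= doubleS subSS.
have -> : ((n + k).+1 - k.*2 = (n - k).+1)%N by rewrite -addnn; lia.
have -> : (n + k - k.*2 = n - k)%N by rewrite -addnn subnDr.
have -> : (k.*2.+1 - k = k.+1)%N by rewrite -addnn; lia.
rewrite !natrM -!natr1 !natrD natrB//.
rewrite -addnn natrD exprS.
set a := ('C(_, _))%:R; set b := ('C(_, _))%:R; set c := ('C(_, _))%:R.
set d := ('C(_, _))%:R; set e := ('C(_, _))%:R; set f := ('C(_, _))%:R.
set g := ('C(_, _))%:R.
set N : R := n%:R; set K : R := k%:R; set s := _ ^+ _.
move=> E1 E2 E3 E4 E5.
have EG : (K + 1) * ((K + 1) * (g + d + c)) = (K + K + 1 + 1) * (K + K + 1) * d.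
  by rewrite -E4 -[RHS]mulrA E5; ring.
have EF : (N - K) * (N + K + 1) * a = (K + K + 1) * (K + K + 1 + 1) * (f + e).
  by rewrite -mulrA E1 -E2 -[RHS]mulrA E3; ring.
rewrite /s !exprS expr0.
transitivity (- (-1) ^+ (n + k) * (f + e) * ((K + 1) * ((K + 1) * (g + d + c)))).
  by ring.
rewrite EG; transitivity (- (-1) ^+ (n + k) * ((N - K) * (N + K + 1) * a) * d).
  by rewrite EF; ring.
by ring.
Qed.

Definition slegendre (R : numFieldType) (n : nat) : {poly R} :=
  \poly_(k < n.+1) slegendre_coef R n k.

Lemma coef_slegendre (R : numFieldType) (n k : nat) :
  (slegendre R n)`_k = slegendre_coef R n k.
Proof.
by rewrite coef_poly ltnS; case: leqP => // /slegendre_coef_small ->.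
Qed.

Lemma slegendre_coef0n (R : numFieldType) (k : nat) :
  slegendre_coef R 0 k = (k == 0%N)%:R.
Proof.
case: k => [|k]; last by rewrite slegendre_coef_small.
by rewrite /slegendre_coef /dirichlet_coef expr0 !bin0 !mulr1.
Qed.

Lemma slegendre0 (R : numFieldType) : slegendre R 0 = 1.
Proof. by apply/polyP => k; rewrite coef_slegendre slegendre_coef0n coef1. Qed.

Lemma slegendre1 (R : numFieldType) : slegendre R 1 = 2%:P * 'X - 1.
Proof.
apply/polyP => k; rewrite coef_slegendre coefB coefCM coefX coef1.
case: k => [|[|k]]; last by rewrite slegendre_coef_small// mulr0 subr0.
  by rewrite /slegendre_coef /dirichlet_coef !bin0 expr1 !mulr1 mulr0 sub0r.
by rewrite /slegendre_coef /dirichlet_coef sqrrN expr1n binn !mul1r subr0 mulr1.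
Qed.

(** After multiplication by [(k + 1)^2], the two coefficient relations express
    every term as a multiple of one coefficient of index [(n + 1, k)], and a
    polynomial identity in [n] and [k] remains. *)
Lemma slegendre_rec (R : numFieldType) (n : nat) :
  (n%:R + 2)%:P * slegendre R n.+2 =
  (2 * n%:R + 3)%:P * ((2%:P * 'X - 1) * slegendre R n.+1)
  - (n%:R + 1)%:P * slegendre R n.
Proof.
apply/polyP => k.
rewrite coefB !coefCM mulrBl coefB mul1r -mulrA coefCM coefXM !coef_slegendre.
have U1 := slegendre_coef_recn R n k; have U2 := slegendre_coef_recn R n.+1 k.
case: k => [|k] /= in U1 U2 *.
  have N m : (m%:R + 1 : R) != 0 by rewrite natr1 pnatr_eq0.
  have {}U1 : slegendre_coef R n.+1 0 = - slegendre_coef R n 0.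
    by apply: (mulfI (N n)); move: U1; rewrite subr0 addr0 mulNr mulrN.
  have {}U2 : slegendre_coef R n.+2 0 = - slegendre_coef R n.+1 0.
    by apply: (mulfI (N n.+1)); move: U2; rewrite subr0 addr0 mulNr mulrN.
  by rewrite U2 U1; ring.
have {}U1 := slegendre_coef_recn R n k; have {}U2 := slegendre_coef_recn R n.+1 k.
have V0 := slegendre_coef_reck R n k; have V1 := slegendre_coef_reck R n.+1 k.
have V2 := slegendre_coef_reck R n.+2 k.
have K0 : (k.+1%:R ^+ 2 : R) != 0 by rewrite expf_neq0// pnatr_eq0.
apply: (mulfI K0).
move: U1 U2 V0 V1 V2; rewrite -!(natr1 n.+1) -!(natr1 n).
set a0 := slegendre_coef _ n k; set a1 := slegendre_coef _ n.+1 k.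
set a2 := slegendre_coef _ n.+2 k; set b0 := slegendre_coef _ n k.+1.
set b1 := slegendre_coef _ n.+1 k.+1; set b2 := slegendre_coef _ n.+2 k.+1.
set N : R := n%:R; set L := _ ^+ 2 => U1 U2 V0 V1 V2.
transitivity ((N + 2) * (L * b2)); first ring.
transitivity ((2 * N + 3) * (2 * L * a1 - L * b1) - (N + 1) * (L * b0)); last ring.
rewrite V0 V1 V2 /L -natr1; set K : R := k%:R in U1 U2 *.
transitivity (- (N + 2) * (N + 3 + K) * ((N + 1 + 1 - K) * a2)); first ring.
transitivity ((2 * N + 3) * (2 * (K + 1) ^+ 2 * a1
  - (K * (K + 1) - (N + 1) * (N + 1 + 1)) * a1) + (N + 1) * (N - K) *
   ((N + 1 + K) * a0)); last ring.
have -> : (N + 1 + K) * a0 = - ((N + 1 - K) * a1) by rewrite U1; ring.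
by rewrite U2; ring.
Qed.

(** The Legendre equation on [[0, 1]]; its left-hand side is symmetric for the
    [L^2] pairing, which is what makes the polynomials orthogonal. *)
Lemma slegendre_ode (R : numFieldType) (n : nat) :
  (('X - 'X^2) * (slegendre R n)^`())^`() =
  - (n%:R * (n%:R + 1))%:P * slegendre R n.
Proof.
apply/polyP => k; rewrite mulNr coefN coefCM coef_deriv mulrBl coefB.
rewrite coefXM coefXnM !coef_deriv !coef_slegendre /=.
have V := slegendre_coef_reck R n k.
case: k => [|[|k]] in V *; rewrite /= ?coef_deriv ?coef_slegendre.
- by move: V; rewrite mulr1n expr1n mul1r => ->; rewrite mul0r subr0; ring.
- rewrite mulr1n.
  have {}V : 2 ^+ 2 * slegendre_coef R n 2 =
    (1 * (1 + 1) - n%:R * (n%:R + 1)) * slegendre_coef R n 1 by rewrite -V.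
  transitivity (2 ^+ 2 * slegendre_coef R n 2 - 2 * slegendre_coef R n 1); first ring.
  by rewrite V; ring.
- transitivity (k.+3%:R ^+ 2 * slegendre_coef R n k.+3 -
    k.+2%:R * (k.+2%:R + 1) * slegendre_coef R n k.+2).
    rewrite !subSS subn0 -[LHS]mulr_natr -(mulr_natr (slegendre_coef R n k.+3)).
    by rewrite -(mulr_natr (slegendre_coef R n k.+2)) -(natr1 k.+2); ring.
  by rewrite V; ring.
Qed.

Lemma size_slegendre (R : numFieldType) (n : nat) : size (slegendre R n) = n.+1.
Proof.
apply: size_poly_eq.
rewrite /slegendre_coef /dirichlet_coef addnn binn mulr1.
by rewrite mulf_neq0 ?signr_eq0// pnatr_eq0 -lt0n bin_gt0 -addnn leq_addl.
Qed.

(** * From the generating function to the Legendre polynomials *)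

Lemma bernoulli_ineq (R : realFieldType) (d : R) (n : nat) :
  0 <= d -> 1 + n%:R * d <= (1 + d) ^+ n.
Proof.
move=> d0; elim: n => [|n IH]; first by rewrite mul0r addr0 expr0.
rewrite exprS -natr1; apply: (@le_trans _ _ ((1 + d) * (1 + n%:R * d))).
  by have := mulr_ge0 (mulr_ge0 (ler0n R n) d0) d0; nra.
by rewrite ler_pM2l// ltr_pwDl.
Qed.

(** The factor [n + 1] produced by differentiation is absorbed by a slightly
    larger geometric ratio, by means of Bernoulli's inequality. *)
Lemma is_cvg_pseries_diffs_inside (R : realType) (c : R^nat) (K z : R) :
  cvgn (pseries c K) -> `|z| < `|K| -> cvgn (pseries (pseries_diffs c) z).
Proof.
move=> cK zK.
have K0 : 0 < `|K| by exact: le_lt_trans zK.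
have [w /andP[zw wK]] : exists w : R, `|z| < w < `|K|.
  by exists ((`|z| + `|K|) / 2); rewrite midf_lt//= midf_lt.
have [v /andP[zv vw]] : exists v : R, `|z| < v < w.
  by exists ((`|z| + w) / 2); rewrite midf_lt//= midf_lt.
have v0 : 0 < v by exact: le_lt_trans zv.
have w0 : 0 < w by exact: lt_trans vw.
have [N [Nreal Nf]] := cvg_series_bounded cK.
pose M := `|N| + 1.
have Mf n : `|c n| * `|K| ^+ n <= M.
  by rewrite -normrX -normrM Nf// (le_lt_trans (ler_norm _))// ltrDl.
pose d := w / v - 1.
have d0 : 0 < d by rewrite subr_gt0 ltr_pdivlMr// mul1r.
(* [w / v = 1 + d], and [(1 + d) ^ (n + 1)] is at least [(n + 1) d]. *)
have vwn n : n.+1%:R * v ^+ n <= (d * v)^-1 * w ^+ n.+1.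
  rewrite ler_pdivlMl ?mulr_gt0//.
  have -> : w = (1 + d) * v by rewrite /d addrC subrK divfK// gt_eqF.
  have -> : d * v * (n.+1%:R * v ^+ n) = n.+1%:R * d * v ^+ n.+1.
    by rewrite exprS; ring.
  rewrite exprMn ler_wpM2r ?exprn_ge0 ?(ltW v0)//.
  by apply: le_trans (bernoulli_ineq n.+1 (ltW d0)); rewrite lerDr ler01.
have M0 : 0 <= M by rewrite addr_ge0.
have p0 := (ltW v0, ltW w0, ltW d0, ltW K0, M0).
apply: normed_cvg.
apply: (@series_le_cvg _ _ (geometric (M / `|K| * (d * v)^-1 * w) (w / `|K|))).
- by move=> n /=.
- by move=> n; rewrite /geometric /= ?mulr_ge0 ?exprn_ge0 ?divr_ge0 ?invr_ge0 ?mulr_ge0 ?p0.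
- move=> n; rewrite /geometric /= /pseries_diffs !normrM normrX normr_nat.
  rewrite mulrAC.
  apply: (@le_trans _ _ ((d * v)^-1 * w ^+ n.+1 * `|c n.+1|)).
    rewrite ler_wpM2r// (le_trans _ (vwn n))// ler_wpM2l//.
    by apply: lerXn2r; rewrite ?nnegrE ?p0// ltW.
  apply: (@le_trans _ _ ((d * v)^-1 * w ^+ n.+1 * (M / `|K| ^+ n.+1))).
    rewrite ler_wpM2l ?mulr_ge0 ?exprn_ge0 ?invr_ge0 ?mulr_ge0 ?p0//.
    by rewrite ler_pdivlMr ?exprn_gt0.
  rewrite expr_div_n !exprS le_eqVlt; apply/orP; left; apply/eqP; field.
  by rewrite !gt_eqF// exprn_gt0.
- by apply: is_cvg_geometric_series; rewrite ger0_norm ?divr_ge0 ?p0// ltr_pdivrMr// mul1r.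
Qed.

Section pseries_identity.
Variable R : realType.
Implicit Types (c : R^nat) (e : R).

Definition pseries_sum c t : R := limn (pseries c t).

Lemma pseries_inside_ball c e : (forall t, `|t| < e -> cvgn (pseries c t)) ->
  forall t, `|t| < e -> cvgn (pseries (pseries_diffs c) t).
Proof.
move=> H t te.
have m := midf_lt te.
have p : 0 < (`|t| + e) / 2 by rewrite (le_lt_trans (normr_ge0 t))// m.
apply: (is_cvg_pseries_diffs_inside (K := (`|t| + e) / 2)).
  by apply: H; rewrite gtr0_norm// m.
by rewrite (gtr0_norm p) m.
Qed.

(** Term-by-term differentiation requires convergence of the first two derived
    series; inside the disc it is automatic. *)
Lemma is_derive_pseries_sum c e : (forall t, `|t| < e -> cvgn (pseries c t)) ->
  forall t, `|t| < e -> is_derive (t : R) (1 : R) (pseries_sum c) (pseries_sum (pseries_diffs c) t).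
Proof.
move=> H t te.
have m := midf_lt te.
have p : 0 < (`|t| + e) / 2 by rewrite (le_lt_trans (normr_ge0 t))// m.
have H1 := pseries_inside_ball H.
have H2 := pseries_inside_ball H1.
apply: (@pseries_snd_diffs _ c ((`|t| + e) / 2)).
- by apply: H; rewrite gtr0_norm// m.
- by apply: H1; rewrite gtr0_norm// m.
- by apply: H2; rewrite gtr0_norm// m.
- by rewrite (gtr0_norm p) m.
Qed.

Lemma pseries0 c : pseries c 0 @ \oo --> c 0%N.
Proof.
rewrite -cvg_shiftS; apply: cvg_near_cst; near=> n.
rewrite /pseries /series /= big_nat_recl// expr0 mulr1 big1 ?addr0// => i _.
by rewrite expr0n mulr0.
Unshelve. all: by end_near. Qed.

(** By induction on [n] for all series at once: the derived series also vanishes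
    near [0], and its coefficient of index [n] is [(n + 1) c (n + 1)]. *)
Lemma pseries_eq0 c e : 0 < e ->
  (forall t, `|t| < e -> pseries c t @ \oo --> 0) -> forall n, c n = 0.
Proof.
move=> e0 H n; elim: n c H => [|n IH] c H.
  have := H 0; rewrite normr0 => /(_ e0) H0.
  exact: (cvg_unique (@Rhausdorff R) (pseries0 (c := c)) H0).
suff : pseries_diffs c n = 0.
  by rewrite /pseries_diffs => /eqP; rewrite mulf_eq0 pnatr_eq0 /= => /eqP.
apply: IH => t te.
have cH s : `|s| < e -> cvgn (pseries c s) by move=> /H; apply: cvgP.
have D := is_derive_pseries_sum cH te.
have D0 : is_derive (t : R) (1 : R) (pseries_sum c) 0.
  apply: (@near_eq_is_derive _ _ _ (cst 0)).
    near=> s; apply/esym/(cvg_lim (@Rhausdorff R))/H; near: s.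
    by apply: (@cvgr_norm_lt _ R^o _ _ _ id); [exact: cvg_id|].
suff -> : 0 = pseries_sum (pseries_diffs c) t.
  exact: (pseries_inside_ball cH te).
by rewrite -(@derive_val _ _ _ _ _ _ _ D) (@derive_val _ _ _ _ _ _ _ D0).
Unshelve. all: by end_near. Qed.
End pseries_identity.

(** The coefficients of the power series multiplied by its variable. *)
Definition pshift (R : realType) (c : R^nat) (n : nat) : R :=
  if n is m.+1 then c m else 0.

Lemma pseries_pshift (R : realType) (c : R^nat) (t l : R) :
  pseries c t @ \oo --> l -> pseries (pshift c) t @ \oo --> t * l.
Proof.
move=> cl; rewrite -cvg_shiftS.
rewrite (_ : [sequence _]_n = (fun n => t * pseries c t n)).
  exact: cvgM (cvg_cst _) cl.
apply/funext => n; rewrite /pseries /series /= big_nat_recl//= mul0r add0r.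
by rewrite mulr_sumr; apply: eq_bigr => i _; rewrite exprS mulrCA.
Qed.

(** The generating function [G] satisfies [(1 - 2xt + t^2) G' = (x - t) G]. *)
Lemma is_derive_legendre_gen (R : realType) (x t : R) :
  0 < 1 - 2 * x * t + t ^+ 2 ->
  is_derive t (1 : R) (fun t => (1 - 2 * x * t + t ^+ 2) `^ (- 2^-1))
   ((x - t) / (1 - 2 * x * t + t ^+ 2) * (1 - 2 * x * t + t ^+ 2) `^ (- 2^-1)).
Proof.
move=> q0; pose q t : R := 1 - 2 * x * t + t ^+ 2.
have Dq : is_derive t (1 : R) q (2 * (t - x)).
  by apply: is_derive_eq; rewrite /GRing.scale /=; ring.
have := @is_derive1_comp _ (fun u => u `^ (- 2^-1)) q t _ _ (is_derive1_powR (- 2^-1) q0) Dq.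
move=> H; apply: is_derive_eq.
have -> : - 2^-1 - 1 = - 1 + - 2^-1 :> R by rewrite addrC.
rewrite -/(q t) powRD; last by rewrite (gt_eqF q0) implybT.
rewrite powR_inv1 ?ltW//.
by field; rewrite gt_eqF.
Qed.

(** Comparing coefficients in the differential equation of the generating
    function gives the three-term recurrence. *)
Lemma is_legendre_rec (R : realType) (P : nat -> {poly R}) (x : R) :
  is_legendre P ->
  [/\ (P 0).[x] = 1, (P 1).[x] = x &
   forall n, (n%:R + 2) * (P n.+2).[x] =
     (2 * n%:R + 3) * (x * (P n.+1).[x]) - (n%:R + 1) * (P n).[x]].
Proof.
move=> /(_ x) HP; pose p n := (P n).[x].
pose q t : R := 1 - 2 * x * t + t ^+ 2.
have : \forall t \near (0 : R), pseries p t @ \oo --> q t `^ (- 2^-1) /\ 0 < q t.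
  near=> t; split; first by near: t.
  near: t; apply: (@cvgr_gt _ _ _ _ q (q 0)).
    apply: cvgD; first (apply: cvgB; first exact: cvg_cst).
      by apply: cvgMl_tmp; exact: cvg_id.
    by apply: exprn_continuous.
  by rewrite /q mulr0 subr0 expr0n addr0.
move=> /nbhs_ballP[e /= e0 He].
have {}He t : `|t| < e -> pseries p t @ \oo --> q t `^ (- 2^-1) /\ 0 < q t.
  by move=> te; apply: He; rewrite /ball /= sub0r normrN.
have cp t : `|t| < e -> cvgn (pseries p t) by move=> /He[+ _]; exact: cvgP.
pose a := pseries_diffs p.
(* The coefficients of [(1 - 2xt + t^2) G' - (x - t) G]. *)
pose d n := a n - 2 * x * pshift a n + pshift (pshift a) n - x * p n + pshift p n.
have aE t : `|t| < e -> pseries a t @ \oo --> (x - t) / q t * q t `^ (- 2^-1).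
  move=> te; have D := is_derive_pseries_sum cp te.
  have [_ qt0] := He _ te.
  have D1 : is_derive t (1 : R) (pseries_sum p) ((x - t) / q t * q t `^ (- 2^-1)).
    apply: (near_eq_is_derive _ (is_derive_legendre_gen qt0)).
    near=> s; apply/esym/(cvg_lim (@Rhausdorff R)).
    have /He[] // : `|s| < e; near: s.
    by apply: (@cvgr_norm_lt _ R^o _ _ _ id); [exact: cvg_id|].
  rewrite -(@derive_val _ _ _ _ _ _ _ D1) (@derive_val _ _ _ _ _ _ _ D).
  exact: (pseries_inside_ball cp te).
have d0 : forall n, d n = 0.
  apply: (pseries_eq0 e0) => t te.
  have [Gt qt0] := He _ te.
  have At := aE _ te.
  have A1 := pseries_pshift At; have A2 := pseries_pshift A1.
  have G1 := pseries_pshift Gt.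
  have Z := cvgD (cvgB (cvgD (cvgB At (cvgMl_tmp (a:=2 * x) A1)) A2)
     (cvgMl_tmp (a:=x) Gt)) G1.
  set l := (X in _ --> X) in Z.
  have l0 : l = 0 by rewrite /l /q; field; rewrite gt_eqF.
  rewrite -l0; have {}Z := Z _ _ _ _ _ _.
  set g := (X in X x0 @[x0 --> \oo] --> _) in Z.
  suff -> : pseries d t = g by exact: Z.
  apply/funext => n; rewrite /g !fctE /pseries /series /= !mulr_sumr.
  rewrite -!(sumrB, big_split) /=.
  by apply: eq_bigr => i _; rewrite /d; ring.
have p0 : p 0%N = 1.
  have [] := He 0; first by rewrite normr0.
  rewrite {1}/q mulr0 subr0 expr0n addr0 powR1 => H _.
  exact: (cvg_unique (@Rhausdorff R) (pseries0 (c := p)) H).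
have p1 : p 1%N = x.
  have /eqP := d0 0%N; rewrite /d /a /pseries_diffs /= p0 !mulr0.
  by rewrite subr0 !addr0 mulr1 mul1r subr_eq0 => /eqP.
split => // -[|n].
  have := d0 1%N; rewrite /d /a /pseries_diffs /= -/(p 2) -/(p 1%N) -/(p 0%N) p0 p1.
  move=> E; apply/eqP; rewrite -subr_eq0 -E; apply/eqP; ring.
have := d0 n.+2; rewrite /d /a /pseries_diffs /= -/(p n.+3) -/(p n.+2) -/(p n.+1).
move=> E; apply/eqP; rewrite -subr_eq0 -E -!natr1; apply/eqP; ring.
Unshelve. all: by end_near. Qed.

Lemma slegendre_rec_horner (R : realType) (n : nat) (z : R) :
  (n%:R + 2) * (slegendre R n.+2).[z] =
  (2 * n%:R + 3) * ((2 * z - 1) * (slegendre R n.+1).[z])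
  - (n%:R + 1) * (slegendre R n).[z].
Proof.
have := congr1 (horner^~ z) (slegendre_rec R n).
by rewrite !(hornerM, hornerD, hornerN, hornerC, hornerX).
Qed.

Lemma is_legendreE (R : realType) (P : nat -> {poly R}) (n : nat) (z : R) :
  is_legendre P -> (P n).[2 * z - 1] = (slegendre R n).[z].
Proof.
move=> /(is_legendre_rec (2 * z - 1))[P0 P1 Prec].
suff : (P n).[2 * z - 1] = (slegendre R n).[z] /\
       (P n.+1).[2 * z - 1] = (slegendre R n.+1).[z] by case.
elim: n => [|n [IH0 IH1]].
  by rewrite P0 P1 slegendre0 slegendre1 !hornerE.
split=> //; have n2 : n%:R + 2 != 0 :> R by rewrite -natrD pnatr_eq0 addn2.
apply: (mulfI n2); rewrite Prec IH0 IH1.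
by rewrite slegendre_rec_horner.
Qed.

Lemma slegendre_sym (R : realType) (n : nat) (z : R) :
  (slegendre R n).[1 - z] = (- 1) ^+ n * (slegendre R n).[z].
Proof.
suff : (slegendre R n).[1 - z] = (- 1) ^+ n * (slegendre R n).[z] /\
  (slegendre R n.+1).[1 - z] = (- 1) ^+ n.+1 * (slegendre R n.+1).[z] by case.
elim: n => [|n [IH0 IH1]].
  by rewrite slegendre0 slegendre1 !hornerE; split; ring.
split=> //; have n2 : n%:R + 2 != 0 :> R by rewrite -natrD pnatr_eq0 addn2.
apply: (mulfI n2).
rewrite slegendre_rec_horner [RHS]mulrCA slegendre_rec_horner IH0 IH1 !exprS.
by ring.
Qed.

(** * Density of polynomials in the square integrable functions *)

Section poly_approx_closure.
Variable R : realType.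
Notation mu := (@lebesgue_measure R).
Notation D := (`]0%R, 1%R[%classic : set R).
Implicit Types u v : R -> R.

Definition sqint u : \bar R := (\int[mu]_(x in D) (u x ^+ 2)%:E)%E.

(** Membership in the closure of the polynomials in [L^2(0,1)]. *)
Definition poly_approx u : Prop := measurable_fun D u /\
  forall e : R, 0 < e -> exists p : {poly R}, (sqint (fun x => u x - p.[x])%R < e%:E)%E.

Lemma measurable_horner (A : set R) (p : {poly R}) : measurable_fun A (horner p).
Proof.
by apply: measurable_funTS; apply: continuous_measurable_fun; exact: continuous_horner.
Qed.

Lemma measurable_sq u : measurable_fun D u ->
  measurable_fun D (fun x => (u x ^+ 2)%:E).
Proof. by move=> mu_; apply/measurable_EFinP; exact: measurable_funX. Qed.

Lemma sqint_ge0 u : (0 <= sqint u)%E.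
Proof. by apply: integral_ge0 => x _; rewrite lee_fin sqr_ge0. Qed.

Lemma eq_sqint u v : {in D, u =1 v} -> sqint u = sqint v.
Proof. by move=> uv; apply: eq_integral => x xD; rewrite uv. Qed.

(** The constant [2] replaces the triangle inequality for the norm: squared norms
    suffice for density arguments and avoid square roots of integrals. *)
Lemma sqintD u v : measurable_fun D u -> measurable_fun D v ->
  (sqint (fun x => u x + v x)%R <= 2%:E * sqint u + 2%:E * sqint v)%E.
Proof.
move=> mfu mfv; rewrite /sqint.
rewrite -!ge0_integralZl//; try exact: measurable_sq; try by (move=> x _; rewrite lee_fin sqr_ge0).
rewrite -ge0_integralD//; try (by move=> x _; rewrite -EFinM lee_fin mulr_ge0 ?sqr_ge0);
  try by apply: measurable_funeM; exact: measurable_sq.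
apply: ge0_le_integral => //.
- by move=> x _; rewrite lee_fin sqr_ge0.
- by apply: measurable_sq; exact: measurable_funD.
- by apply: emeasurable_funD; apply: measurable_funeM; exact: measurable_sq.
- move=> x _; rewrite -!EFinM -EFinD lee_fin.
  by have := sqr_ge0 (u x - v x); nra.
Qed.

Lemma sqintZ u k : measurable_fun D u ->
  (sqint (fun x => k * u x)%R = (k ^+ 2)%:E * sqint u)%E.
Proof.
move=> mfu; rewrite /sqint -ge0_integralZl ?lee_fin ?sqr_ge0//.
- by apply: eq_integral => x _; rewrite exprMn EFinM.
- exact: measurable_sq.
- by move=> x _; rewrite lee_fin sqr_ge0.
Qed.

Lemma poly_approx_horner p : poly_approx (horner p).
Proof.
split; first exact: measurable_horner.
move=> e e0; exists p; rewrite /sqint integral0_eq ?lte_fin// => x _.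
by rewrite subrr expr0n.
Qed.

Lemma poly_approx_close u : measurable_fun D u ->
  (forall e : R, 0 < e -> exists2 v, poly_approx v & (sqint (fun x => u x - v x)%R < e%:E)%E) ->
  poly_approx u.
Proof.
move=> mfu H; split=> // e e0; have e4 : 0 < e / 4 by rewrite divr_gt0.
have [v [mfv Hv] uv] := H _ e4; have [p vp] := Hv _ e4.
exists p; rewrite (@eq_sqint _ (fun x => (u x - v x) + (v x - p.[x]))); last first.
  by move=> x _; rewrite addrA subrK.
have mp := @measurable_horner D p.
apply: le_lt_trans (sqintD _ _) _; [exact: measurable_funB|exact: measurable_funB|].
have -> : e%:E = (2%:E * (e / 4)%:E + 2%:E * (e / 4)%:E)%E.
  by rewrite -!EFinM -EFinD; congr (_%:E); field.
by apply: lteD; rewrite lte_pmul2l.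
Qed.

Lemma poly_approx_eq u v : {in D, u =1 v} -> poly_approx v -> poly_approx u.
Proof.
move=> uv [mv Hv]; split.
  by apply: eq_measurable_fun mv => x xD; rewrite uv.
move=> e /Hv[p vp]; exists p; rewrite (eq_sqint (v := fun x => v x - p.[x]))// => x xD.
by rewrite uv.
Qed.

Lemma poly_approxD u v : poly_approx u -> poly_approx v ->
  poly_approx (fun x => u x + v x).
Proof.
move=> [mfu Hu] [mfv Hv]; split; first exact: measurable_funD.
move=> e e0; have e4 : 0 < e / 4 by rewrite divr_gt0.
have [p up] := Hu _ e4; have [q vq] := Hv _ e4.
have mp := @measurable_horner D p; have mq := @measurable_horner D q.
exists (p + q); rewrite (@eq_sqint _ (fun x => (u x - p.[x]) + (v x - q.[x]))); last first.
  by move=> x _; rewrite hornerD; ring.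
apply: le_lt_trans (sqintD _ _) _; [exact: measurable_funB|exact: measurable_funB|].
have -> : e%:E = (2%:E * (e / 4)%:E + 2%:E * (e / 4)%:E)%E.
  by rewrite -!EFinM -EFinD; congr (_%:E); field.
by apply: lteD; rewrite lte_pmul2l.
Qed.

Lemma poly_approxZ u k : poly_approx u -> poly_approx (fun x => k * u x).
Proof.
move=> [mfu Hu]; split; first exact: measurable_funM.
move=> e e0; have k1 : 0 < k ^+ 2 + 1 by rewrite ltr_wpDl ?sqr_ge0.
have [|p up] := Hu (e / (k ^+ 2 + 1)); first by rewrite divr_gt0.
have mp := @measurable_horner D p.
exists (k *: p); rewrite (@eq_sqint _ (fun x => k * (u x - p.[x]))); last first.
  by move=> x _; rewrite hornerZ mulrBr.
rewrite sqintZ; last exact: measurable_funB.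
apply: (@le_lt_trans _ _ ((k ^+ 2 + 1)%:E * sqint (fun x => (u x - p.[x])%R))%E).
  by rewrite lee_wpmul2r ?sqint_ge0// lee_fin lerDl.
by rewrite muleC -lte_pdivlMr// muleC -EFinM mulrC.
Qed.

Lemma poly_approx_sum (I : Type) (s : seq I) (P : pred I) (u : I -> R -> R) :
  (forall i, P i -> poly_approx (u i)) ->
  poly_approx (fun x => \sum_(i <- s | P i) u i x).
Proof.
move=> H; elim: s => [|i s IH].
  apply: (poly_approx_eq _ (poly_approx_horner 0)) => x _.
  by rewrite big_nil horner0.
case: (boolP (P i)) => Pi.
  apply: (poly_approx_eq _ (poly_approxD (H i Pi) IH)) => x _.
  by rewrite big_cons Pi.
apply: (poly_approx_eq _ IH) => x _.
by rewrite big_cons (negbTE Pi).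
Qed.

(** Dominated convergence: the form in which limits enter the density argument. *)
Lemma poly_approx_cvg (u_ : nat -> R -> R) u g : measurable_fun D u ->
  (forall n, poly_approx (u_ n)) ->
  {ae mu, forall x, D x -> u_ ^~ x @ \oo --> u x} ->
  mu.-integrable D (EFin \o g) ->
  (forall n x, D x -> (u x - u_ n x) ^+ 2 <= g x) -> poly_approx u.
Proof.
move=> mfu Hu uu ig ug; apply: poly_approx_close => // e e0.
have mfn n : measurable_fun D (fun x => ((u x - u_ n x) ^+ 2)%:E).
  by apply: measurable_sq; apply: measurable_funB => //; have [] := Hu n.
have [] := @dominated_convergence _ _ _ mu D _
  (fun n x => ((u x - u_ n x) ^+ 2)%:E) (cst 0%E) (EFin \o g) mfn _ _ ig _ => //.
- have F : Filter (almost_everywhere mu) by exact: ae_filter_ringOfSetsType.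
  apply: filterS uu => x H Dx; apply: cvg_EFin; first exact: nearW.
  rewrite [X in _ --> X](_ : _ = (u x - u x) ^+ 2); last by rewrite subrr expr0n.
  apply: (continuous_cvg _ (@exprn_continuous R 2 _)).
  by apply: cvgB; [exact: cvg_cst|exact: H].
- apply: aeW => x n Dx; rewrite gee0_abs ?lee_fin ?sqr_ge0//; exact: ug.
move=> _ _; rewrite integral0 => /fine_cvgP[fin /cvgrPdist_lt /(_ _ e0)].
move=> /(filterI fin) [N _ /(_ N (leqnn N))] /= [fN].
rewrite sub0r normrN => H.
exists (u_ N) => //; rewrite /sqint -[X in (X < _)%E]fineK//.
by rewrite lte_fin (le_lt_trans (ler_norm _)).
Qed.

End poly_approx_closure.

Section poly_approx_indicator.
Variable R : realType.
Notation mu := (@lebesgue_measure R).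
Notation D := (`]0%R, 1%R[%classic : set R).
Implicit Types u v : R -> R.

Lemma onem_expn_ge (d : R) (m : nat) : 0 <= d <= 1 -> 1 - m%:R * d <= (1 - d) ^+ m.
Proof.
move=> /andP[d0 d1]; elim: m => [|m IH]; first by rewrite mul0r subr0 expr0.
rewrite exprS -natr1; apply: (@le_trans _ _ ((1 - d) * (1 - m%:R * d))).
  by have := mulr_ge0 (mulr_ge0 (ler0n R m) d0) d0; nra.
by rewrite ler_wpM2l// subr_ge0.
Qed.

Lemma onem_expn_le (d : R) (m : nat) : 0 < m%:R * d -> 0 <= d <= 1 ->
  (1 - d) ^+ m <= (m%:R * d)^-1.
Proof.
move=> md /andP[d0 d1]; rewrite -[leRHS]mul1r ler_pdivlMr//.
have d1' : 0 <= 1 - d by rewrite subr_ge0.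
apply: (@le_trans _ _ ((1 - d) ^+ m * (1 + d) ^+ m)).
  rewrite ler_wpM2l ?exprn_ge0//.
  by apply: le_trans (bernoulli_ineq m d0); rewrite lerDr.
by rewrite -exprMn exprn_ile1//; nra.
Qed.

(** As [n] grows this tends to [1] for [w < 1/2] and to [0] for [w > 1/2]: the
    power [2 ^ n] beats [w ^ n] exactly when [2 w > 1]. *)
Definition step_poly (n : nat) (w : R) : R := (1 - w ^+ n) ^+ (2 ^ n).

Lemma step_poly01 n w : 0 <= w <= 1 -> 0 <= step_poly n w <= 1.
Proof.
move=> /andP[w0 w1]; have wn : 0 <= w ^+ n <= 1 by rewrite exprn_ge0// exprn_ile1.
rewrite exprn_ge0/= ?exprn_ile1//; lra.
Qed.

Lemma step_poly_cvg1 w : 0 <= w < 2^-1 ->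
  step_poly n w @[n --> \oo] --> (1 : R).
Proof.
move=> /andP[w0 w2].
have wB : 0 <= w <= 1 by lra.
apply: (@squeeze_cvgr _ _ _ _ (fun n => 1 - (2 * w) ^+ n) (cst 1)).
- apply: nearW => n; have /andP[_ ->] := step_poly01 n wB.
  rewrite andbT; apply: le_trans (onem_expn_ge _ _).
    by rewrite natrX exprMn.
  by rewrite exprn_ge0 ?exprn_ile1//; lra.
- rewrite -[X in _ --> X]subr0; apply: cvgB; first exact: cvg_cst.
  by apply: cvg_expr; rewrite ger0_norm; lra.
- exact: cvg_cst.
Qed.

Lemma step_poly_cvg0 w : 2^-1 < w <= 1 ->
  step_poly n w @[n --> \oo] --> (0 : R).
Proof.
move=> /andP[w2 w1].
have wB : 0 <= w <= 1 by lra.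
have w2' : 1 < 2 * w by lra.
apply: (@squeeze_cvgr _ _ _ _ (cst 0) (fun n => ((2 * w)^-1) ^+ n)).
- apply: nearW => n; have /andP[-> _] /= := step_poly01 n wB.
  apply: le_trans (onem_expn_le _ _) _.
  + by rewrite mulr_gt0 ?exprn_gt0 ?ltr0n ?expn_gt0//; lra.
  + by rewrite exprn_ge0 ?exprn_ile1//; lra.
  + by rewrite natrX -exprMn exprVn.
- exact: cvg_cst.
- by apply: cvg_expr; rewrite ger0_norm ?invr_ge0 ?invf_lt1//; lra.
Qed.

Lemma integrable_cst01 (c : R) : mu.-integrable D (EFin \o cst c).
Proof.
apply/integrableP; split; first exact/measurable_EFinP.
rewrite /= integral_cst//= lebesgue_measure_itv/= lte_fin ltr01.
by rewrite oppr0 adde0 mule1 ltry.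
Qed.

Lemma poly_approx_cst (c : R) : poly_approx (fun=> c).
Proof.
by apply: (poly_approx_eq _ (poly_approx_horner c%:P)) => x _; rewrite hornerC.
Qed.

(** On [[0, 1]] the jump of [step_poly] is moved to [a] by an affine change of
    variable that keeps its argument within [[0, 1]]. *)
Lemma poly_approx_ray (a : R) : poly_approx (\1_(`]a, +oo[%classic) : R -> R).
Proof.
have [a0|a0] := ltP a 0.
  apply: (poly_approx_eq _ (poly_approx_cst 1)) => x; rewrite inE/= in_itv/= => /andP[x0 _].
  by rewrite indicE mem_setE in_itv/= andbT (lt_trans a0 x0).
have [a1|a1] := ltP 1 a.
  apply: (poly_approx_eq _ (poly_approx_cst 0)) => x; rewrite inE/= in_itv/= => /andP[_ x0].
  by rewrite indicE mem_setE in_itv/= andbT ltNge (ltW (lt_trans x0 a1)).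
pose w x : R := (1 + a - x) / 2.
have wB x : D x -> 0 <= w x <= 1 by rewrite /D /= in_itv/= /w; lra.
apply: (@poly_approx_cvg _ (fun n x => step_poly n (w x)) _ (cst 1)).
- by apply: measurable_funTS; exact: measurable_indic.
- move=> n.
  (* [step_poly n (w x)] as a polynomial in [x]. *)
  pose p : {poly R} := (1 - (2^-1 *: ((1 + a)%:P - 'X)) ^+ n) ^+ (2 ^ n).
  apply: (poly_approx_eq _ (poly_approx_horner p)) => x _.
  rewrite /p horner_exp hornerD hornerN horner_exp hornerZ hornerD hornerN hornerX !hornerC.
  by rewrite /step_poly /w mulrC.
- have : mu.-negligible [set a].
    by apply/negligibleP => //; exact: lebesgue_measure_set1.
  apply: negligibleS => x /= /not_implyP[Dx H]; apply: contrapT => xa; apply: H.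
  have := wB _ Dx; rewrite indicE mem_setE in_itv/= andbT.
  case: ltgtP xa => [xa _ wx|xa _ wx|//].
  + by apply: step_poly_cvg1; rewrite /w; move: Dx; rewrite /= in_itv/=; lra.
  + by apply: step_poly_cvg0; rewrite /w; move: Dx; rewrite /= in_itv/=; lra.
  + by move=> ->.
- exact: integrable_cst01.
- move=> n x /wB /(step_poly01 n) /andP[s0 s1]; rewrite indicE /=.
  by case: (x \in _) => /=; nra.
Qed.

Lemma sqr_indicB_le1 (b c : R) : 0 <= b <= 1 -> 0 <= c <= 1 -> (b - c) ^+ 2 <= 1.
Proof. by move=> /andP[? ?] /andP[? ?]; nra. Qed.

Lemma indic01 (A : set R) (x : R) : 0 <= (\1_A x : R) <= 1.
Proof. by rewrite indicE; case: (x \in A); rewrite ?lexx ?ler01. Qed.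

(** Rays are stable by intersection and generate the Borel sets, and the sets
    whose indicator lies in the closure form a Dynkin system. *)
Lemma poly_approx_indic (A : set (measurableTypeR R)) : measurable A ->
  poly_approx (\1_A : R -> R).
Proof.
pose G := @RGenOInfty.G R.
have mG : @measurable _ (measurableTypeR R) = <<s G>>.
  exact: RGenOInfty.measurableE.
rewrite mG; move: A.
apply: (@dynkin_induction _ (measurableTypeR R) G (fun A => poly_approx (\1_A : R -> R))) => //.
- move=> _ _ [a ->] [b ->]; exists (Num.max a b); apply/seteqP; split => x /=.
    by rewrite !in_itv/= !andbT gt_max => -[-> ->].
  by rewrite !in_itv/= !andbT gt_max => /andP[-> ->].
- by apply: (poly_approx_eq _ (poly_approx_cst 1)) => x _; rewrite indicT.
- by move=> _ [a ->]; exact: poly_approx_ray.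
- move=> S mS /(poly_approxZ (-1))/(poly_approxD (poly_approx_cst 1)) HS.
  apply: (poly_approx_eq _ HS) => x _.
  by rewrite !indicE in_setC; case: (x \in S) => /=; ring.
- move=> F mF tF HF.
  pose s n x : R := \sum_(i < n) \1_(F i) x.
  have sE n x : s n x = \1_(\big[setU/set0]_(i < n) F i) x.
    elim: n => [|n IH]; first by rewrite /s !big_ord0 indic0.
    rewrite /s !big_ord_recr/= -/(s n x) IH !indicE in_setU.
    have [xn|] := boolP (x \in F n); last by rewrite orbF addr0.
    suff /negbTE -> : x \notin \big[setU/set0]_(i < n) F i by rewrite add0r.
    apply/negP => /set_mem; rewrite -bigcup_mkord => -[i /= ni Fix].
    have : i = n by apply: tF => //; exists x; split=> //; exact/set_mem.
    by move=> E; rewrite E ltnn in ni.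
  apply: (@poly_approx_cvg _ s _ (cst 1)).
  + apply: measurable_funTS; apply: measurable_indic; exact: bigcupT_measurable.
  + by move=> n; apply: poly_approx_sum => i _; exact: HF.
  + apply: aeW => x _.
    have [[n _ Fnx]|nF] := pselect ((\bigcup_k F k) x).
      rewrite indicE mem_set//; last by exists n.
      apply: cvg_near_cst; near=> m; rewrite sE indicE mem_set//.
      rewrite -bigcup_mkord; exists n => //=; near: m; exact: nbhs_infty_gt.
    rewrite indicE memNset//; apply: cvg_near_cst; apply: nearW => m.
    rewrite sE indicE memNset// -bigcup_mkord => -[i _ Fi].
    by apply: nF; exists i.
  + exact: integrable_cst01.
  + by move=> n x _; rewrite sE; apply: sqr_indicB_le1; exact: indic01.
Unshelve. all: by end_near. Qed.

End poly_approx_indicator.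

Section poly_approx_square_integrable.
Variable R : realType.
Notation mu := (@lebesgue_measure R).
Notation D := (`]0%R, 1%R[%classic : set R).
Implicit Types u v : R -> R.
Import HBNNSimple.

Lemma poly_approx_nnsfun (g : {nnsfun (measurableTypeR R) >-> R}) : poly_approx g.
Proof.
pose v (x : R) : R := \sum_(r <- finmap.enum_fset (fset_set (range g))) (r * \1_(g @^-1` [set r]) x).
apply: (@poly_approx_eq R g v).
  by move=> x _; rewrite (fimfunE g) fsbig_finite.
apply: poly_approx_sum => r _; apply: poly_approxZ.
by apply: poly_approx_indic.
Qed.

(** Increasing simple functions approximate [u], and the squared error is
    dominated by [u ^ 2]. *)
Lemma poly_approx_ge0 u : measurable_fun D u -> (forall x, 0 <= u x) ->
  mu.-integrable D (fun x => (u x ^+ 2)%:E) -> poly_approx u.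
Proof.
move=> mfu u0 iu2.
have mD : measurable (D : set (measurableTypeR R)) by exact: measurable_itv.
have mEu : measurable_fun D (EFin \o u) by exact/measurable_EFinP.
pose g_ := nnsfun_approx mD mEu.
have gcvg x : D x -> g_ n x @[n --> \oo] --> u x.
  move=> Dx.
  have /fine_cvgP[_] : (g_ n x)%:E @[n --> \oo] --> (u x)%:E; last by [].
  by apply: (@cvg_nnsfun_approx _ _ _ _ mD _ mEu _ x Dx) => y _; rewrite lee_fin.
have gu n x : D x -> 0 <= g_ n x <= u x.
  move=> Dx; rewrite fun_ge0 /=.
  have ug := gcvg _ Dx.
  rewrite -(cvg_lim (@Rhausdorff R) ug); apply: nondecreasing_cvgn_le.
    by move=> a b ab; have /lefP := @nd_nnsfun_approx _ _ _ _ mD _ mEu _ _ ab; exact.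
  exact: cvgP ug.
apply: (@poly_approx_cvg _ (fun n => g_ n) _ (fun x => u x ^+ 2)) => //.
- by move=> n; exact: poly_approx_nnsfun.
- exact: aeW.
- by move=> n x /(gu n) /andP[? ?]; nra.
Qed.

(** The closure is a vector space, so that the case of a function of constant
    sign suffices. *)
Theorem poly_approx_L2 u : measurable_fun D u ->
  mu.-integrable D (fun x => (u x ^+ 2)%:E) -> poly_approx u.
Proof.
move=> mfu iu2.
have part s : s ^+ 2 = 1 -> poly_approx (fun x => Num.max (s * u x) 0).
  move=> s1.
  have mp : measurable_fun D (fun x => Num.max (s * u x) 0).
    by apply: measurable_maxr => //; exact: measurable_funM.
  apply: poly_approx_ge0 => //; first by move=> x; rewrite le_max lexx orbT.
  apply: (le_integrable _ _ _ iu2) => //; first exact: measurable_sq.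
  move=> x _ /=; rewrite lee_fin !ger0_norm ?sqr_ge0//.
  have -> : u x ^+ 2 = (s * u x) ^+ 2 by rewrite exprMn s1 mul1r.
  by rewrite /Num.max; case: ltP => _ //; rewrite expr0n sqr_ge0.
(* The positive and negative parts of [u]. *)
have p1 := part 1 (expr1n _ _).
have pN1 : poly_approx (fun x => Num.max (- 1 * u x) 0).
  by apply: part; rewrite sqrrN expr1n.
apply: (poly_approx_eq _ (poly_approxD p1 (poly_approxZ (-1) pN1))) => x _.
rewrite mul1r !mulN1r /Num.max oppr_lt0.
by case: ltrgtP => [||->]; rewrite ?oppr0 ?opprK ?addr0 ?add0r.
Qed.

End poly_approx_square_integrable.

(** * Orthonormality and completeness of the Legendre polynomials *)

Section legendre_orthogonality.
Variable R : realType.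
Notation mu := (@lebesgue_measure R).
Notation D := (`]0%R, 1%R[%classic : set R).
Implicit Types p q r : {poly R}.

Definition int01 p : R := Rintegral mu D (fun x => p.[x]).

Lemma integrable_horner p : mu.-integrable D (EFin \o horner p).
Proof.
have H : mu.-integrable `[0, 1] (EFin \o horner p).
  apply: continuous_compact_integrable; first exact: segment_compact.
  by apply: continuous_subspaceT; exact: continuous_horner.
by apply: integrableS H => //; exact: subset_itv_oo_cc.
Qed.

Lemma int01D p q : int01 (p + q) = int01 p + int01 q.
Proof.
have <- := @RintegralD _ _ _ _ _ _ _ _ (integrable_horner p) (integrable_horner q) => //.
by rewrite /int01; apply: eq_Rintegral => x _; rewrite hornerD.
Qed.

Lemma int01Z k p : int01 (k *: p) = k * int01 p.
Proof.
have <- := @RintegralZl _ _ _ _ _ _ k _ (integrable_horner p) => //.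
by rewrite /int01; apply: eq_Rintegral => x _; rewrite hornerZ.
Qed.

Lemma int01N p : int01 (- p) = - int01 p.
Proof. by rewrite -scaleN1r int01Z mulN1r. Qed.

Lemma int01_deriv p : int01 p^`() = p.[1] - p.[0].
Proof.
rewrite /int01 /Rintegral -(@integral_itv_bndoo _ _ _ _ true false); last first.
  by apply/measurable_EFinP; exact: measurable_horner.
rewrite -[RHS]/(fine (p.[1]%:E - p.[0]%:E)%E); congr fine.
apply: (@continuous_FTC2 _ (horner p^`()) (horner p) 0 1) => //.
- by apply: continuous_subspaceT; exact: continuous_horner.
- split; first by move=> x _; exact: derivable_horner.
    by apply: cvg_at_right_filter; exact: continuous_horner.
  by apply: cvg_at_left_filter; exact: continuous_horner.
- by move=> x _; rewrite derive1E; apply: derive_val; exact: is_derive_poly.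
Qed.

(** Integrating by parts once makes both sides equal to
    [- int (X - X^2) p' q']; no boundary term appears because [X - X^2] vanishes
    at [0] and [1]. *)
Lemma int01_legendre_sym p q :
  int01 ((('X - 'X^2) * p^`())^`() * q) = int01 (p * (('X - 'X^2) * q^`())^`()).
Proof.
have L r s : int01 ((('X - 'X^2) * r^`())^`() * s) = - int01 (('X - 'X^2) * r^`() * s^`()).
  have := int01_deriv ((('X - 'X^2) * r^`()) * s).
  rewrite [_^`()]derivM int01D.
  have w1 : ('X - 'X^2 : {poly R}).[1] = 0.
    by rewrite !(hornerD, hornerN, hornerX, hornerXn) expr1n subrr.
  have w0 : ('X - 'X^2 : {poly R}).[0] = 0.
    by rewrite !(hornerD, hornerN, hornerX, hornerXn) expr0n subrr.
  rewrite !hornerM w1 w0 !mul0r subrr => /eqP.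
  by rewrite addr_eq0 => /eqP.
by rewrite L [p * _]mulrC L mulrAC.
Qed.

(** Eigenfunctions of a symmetric operator for the distinct eigenvalues
    [- n (n + 1)]. *)
Lemma slegendre_orthogonal m n : m != n ->
  int01 (slegendre R m * slegendre R n) = 0.
Proof.
move=> mn; have := int01_legendre_sym (slegendre R m) (slegendre R n).
rewrite !slegendre_ode -mulrA (mulrCA (slegendre R m)).
rewrite -!polyCN !mul_polyC !int01Z => /eqP; rewrite -subr_eq0 -mulrBl mulf_eq0.
case/orP => [|/eqP//].
rewrite (_ : _ - _ = (n%:R - m%:R) * (n%:R + m%:R + 1)); last by ring.
rewrite mulf_eq0 subr_eq0 eqr_nat eq_sym (negbTE mn) /=.
by rewrite -natrD natr1 pnatr_eq0.
Qed.

(** Pairing the recurrence of index [n] with [slegendre (n + 2)], and that of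
    index [n + 1] with [slegendre (n + 1)], gives two expressions of the integral
    of [x * slegendre (n + 1) * slegendre (n + 2)], where [x = 2X - 1]; hence
    [(2n + 5) |slegendre (n + 2)|^2 = (2n + 3) |slegendre (n + 1)|^2]. *)
Lemma slegendre_sqnorm n :
  int01 (slegendre R n * slegendre R n) = (2 * n%:R + 1)^-1.
Proof.
pose x : {poly R} := 2%:P * 'X - 1.
have recE m k : (m%:R + 2) * int01 (slegendre R m.+2 * slegendre R k) =
    (2 * m%:R + 3) * int01 (x * slegendre R m.+1 * slegendre R k)
    - (m%:R + 1) * int01 (slegendre R m * slegendre R k).
  rewrite -!int01Z -int01N -int01D; congr int01.
  rewrite -!mul_polyC.
  transitivity ((m%:R + 2)%:P * slegendre R m.+2 * slegendre R k); first ring.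
  by rewrite slegendre_rec /x; ring.
have N m : m%:R + 1 != 0 :> R by rewrite natr1 pnatr_eq0.
have N2 m : 2 * m%:R + 1 != 0 :> R by rewrite -natrM natr1 pnatr_eq0.
suff : int01 (slegendre R n * slegendre R n) = (2 * n%:R + 1)^-1 /\
       int01 (slegendre R n.+1 * slegendre R n.+1) = (2 * n.+1%:R + 1)^-1 by case.
elim: n => [|n [_ IH]].
  have i1 : int01 (slegendre R 0 * slegendre R 0) = 1.
    by rewrite slegendre0 mulr1; have := int01_deriv 'X; rewrite derivX !hornerX subr0.
  split; first by rewrite i1 mulr0 add0r invr1.
  have := recE 0%N 0%N; rewrite slegendre_orthogonal// i1.
  have -> : int01 (x * slegendre R 1 * slegendre R 0) = int01 (slegendre R 1 * slegendre R 1).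
    by rewrite slegendre0 mulr1 slegendre1.
  rewrite !mulr0 mulr1 !add0r => /esym/eqP; rewrite subr_eq0 => /eqP E.
  have E3 : (2 * 1 + 1 : R) = 3 by ring.
  have n3 : (3 : R) != 0 by rewrite pnatr_eq0.
  by rewrite E3; apply: (mulfI n3); rewrite E mulfV.
split=> //.
have E1 := recE n n.+2; have E2 := recE n.+1 n.+1.
move: E1 E2; rewrite (@slegendre_orthogonal n n.+2) ?(@slegendre_orthogonal n.+3 n.+1)//; try lia.
rewrite !mulr0 subr0 IH => E1.
have -> : int01 (x * slegendre R n.+2 * slegendre R n.+1) =
    int01 (x * slegendre R n.+1 * slegendre R n.+2) by congr int01; ring.
rewrite -!(natr1 n.+1) -!(natr1 n); set t := int01 (x * _ * _) in E1 *.
set N0 : R := n%:R in E1 * => /esym/eqP; rewrite subr_eq0 => /eqP E2.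
have N3 : N0 + 2 != 0 by rewrite -natrD pnatr_eq0 addn2.
have N4 : 2 * N0 + 5 != 0 by rewrite -natrM -natrD pnatr_eq0 addnS.
have N5 : 2 * N0 + 3 != 0 by rewrite -natrM -natrD pnatr_eq0 addnS.
have -> : int01 (slegendre R n.+2 * slegendre R n.+2) = (2 * N0 + 3) * t / (N0 + 2).
  by rewrite -E1; field.
have -> : t = (N0 + 2) / (2 * N0 + 3) / (2 * N0 + 5).
  apply: (mulfI N4); rewrite (_ : _ * t = (2 * (N0 + 1) + 3) * t); last by ring.
  by rewrite E2; field; rewrite N4 N5.
by field; rewrite N3 N5 !natr1 N2.
Qed.

End legendre_orthogonality.

Section legendre_completeness.
Variable R : realType.
Notation mu := (@lebesgue_measure R).
Notation D := (`]0%R, 1%R[%classic : set R).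
Implicit Types p q : {poly R}.

Definition sq_integrable (u : R -> R) : Prop :=
  measurable_fun D u /\ mu.-integrable D (fun x => (u x ^+ 2)%:E).

Lemma integrable_mul (u v : R -> R) : sq_integrable u -> sq_integrable v ->
  mu.-integrable D (EFin \o (fun x => u x * v x)).
Proof.
move=> [mfu iu] [mfv iv].
apply: (le_integrable _ _ _ (integrableD _ iu iv)) => //.
  by apply/measurable_EFinP; exact: measurable_funM.
move=> x _ /=; rewrite lee_fin [leRHS]ger0_norm ?addr_ge0 ?sqr_ge0// normrM.
rewrite -[u x ^+ 2]real_normK ?num_real// -[v x ^+ 2]real_normK ?num_real//.
by have := sqr_ge0 (`|u x| - `|v x|); have := normr_ge0 (u x); have := normr_ge0 (v x); nra.
Qed.

Lemma sq_integrable_horner p : sq_integrable (horner p).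
Proof.
split; first exact: measurable_horner.
have -> : (fun x => (p.[x] ^+ 2)%:E) = EFin \o horner (p ^+ 2).
  by apply/funext => x /=; rewrite horner_exp.
exact: integrable_horner.
Qed.

Lemma sq_integrableB (u v : R -> R) : sq_integrable u -> sq_integrable v ->
  sq_integrable (fun x => u x - v x).
Proof.
move=> hu hv; have [mfu iu] := hu; have [mfv iv] := hv; split; first exact: measurable_funB.
apply: (le_integrable _ _ _ (integrableD _ (integrableZl _ 2 iu) (integrableZl _ 2 iv))) => //.
  by apply/measurable_EFinP; apply: measurable_funX; exact: measurable_funB.
move=> x _ /=; rewrite lee_fin [leLHS]ger0_norm ?sqr_ge0// [leRHS]ger0_norm.
  by have := sqr_ge0 (u x + v x); nra.
by rewrite addr_ge0// mulr_ge0// sqr_ge0.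
Qed.

Variable h : R -> R.
Hypothesis Lh : sq_integrable h.

Definition legendre_basis n : {poly R} := Num.sqrt (2 * n%:R + 1) *: slegendre R n.

Definition fourier_legendre n : R := Rintegral mu D (fun x => h x * (legendre_basis n).[x]).

Definition legendre_sum N : {poly R} :=
  \sum_(0 <= n < N) fourier_legendre n *: legendre_basis n.

Lemma legendre_basis_orthonormal m n :
  int01 (legendre_basis m * legendre_basis n) = (m == n)%:R.
Proof.
rewrite /legendre_basis -scalerAl -scalerAr !int01Z.
case: eqVneq => [->|mn]; last by rewrite slegendre_orthogonal// !mulr0.
have n0 : 0 < 2 * n%:R + 1 :> R by rewrite ltr_wpDl// mulr_ge0.
by rewrite slegendre_sqnorm mulrA -expr2 sqr_sqrtr ?mulfV ?gt_eqF// ltW.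
Qed.

Lemma int01_sum (I : Type) (s : seq I) (F : I -> {poly R}) :
  int01 (\sum_(i <- s) F i) = \sum_(i <- s) int01 (F i).
Proof.
elim: s => [|i s IH]; last by rewrite !big_cons int01D IH.
by rewrite !big_nil -(scale0r (0 : {poly R})) int01Z mul0r.
Qed.

(** The scalar product of [q] with the remainder of order [N] of the Legendre
    expansion. *)
Definition remainder_pairing N q : R :=
  Rintegral mu D (fun x => (h x - (legendre_sum N).[x]) * q.[x]).

Lemma remainder_pairingE N q : remainder_pairing N q =
  Rintegral mu D (fun x => h x * q.[x]) - int01 (legendre_sum N * q).
Proof.
rewrite /remainder_pairing /int01.
have ip := integrable_horner (legendre_sum N * q).
have <- := @RintegralB _ _ _ _ _ _ _ _ (integrable_mul Lh (sq_integrable_horner q)) ip => //.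
by apply: eq_Rintegral => x _; rewrite hornerM mulrBl.
Qed.

Lemma remainder_pairing_basis N m : (m < N)%N -> remainder_pairing N (legendre_basis m) = 0.
Proof.
move=> mN; rewrite remainder_pairingE -/(fourier_legendre m) /legendre_sum mulr_suml int01_sum.
under eq_bigr do rewrite -scalerAl int01Z legendre_basis_orthonormal.
rewrite big_mkord (bigD1 (Ordinal mN))//= eqxx mulr1 big1 ?addr0 ?subrr// => i im.
suff /negbTE -> : (i : nat) != m by rewrite mulr0.
by apply: contraNneq im => im; apply/eqP/val_inj.
Qed.

Lemma remainder_pairingD N p q :
  remainder_pairing N (p + q) = remainder_pairing N p + remainder_pairing N q.
Proof.
have Lr := sq_integrableB Lh (sq_integrable_horner (legendre_sum N)).
have L s := integrable_mul Lr (sq_integrable_horner s).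
have <- := @RintegralD _ _ _ _ _ _ _ _ (L p) (L q) => //.
by rewrite /remainder_pairing; apply: eq_Rintegral => x _; rewrite hornerD mulrDr.
Qed.

Lemma remainder_pairingZ N k p : remainder_pairing N (k *: p) = k * remainder_pairing N p.
Proof.
have Lr := sq_integrableB Lh (sq_integrable_horner (legendre_sum N)).
have L s := integrable_mul Lr (sq_integrable_horner s).
have <- := @RintegralZl _ _ _ _ _ _ k _ (L p) => //.
by rewrite /remainder_pairing; apply: eq_Rintegral => x _; rewrite hornerZ mulrCA.
Qed.

Lemma size_legendre_basis n : size (legendre_basis n) = n.+1.
Proof.
rewrite size_scale ?size_slegendre// gt_eqF// sqrtr_gt0.
Qed.

(** The remainder is orthogonal to the basis elements of index less than [N];
    these have all degrees less than [N], so that the leading term of [q] can be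
    removed repeatedly. *)
Lemma remainder_pairing_eq0 N q : (size q <= N)%N -> remainder_pairing N q = 0.
Proof.
suff H n : (n <= N)%N -> forall q, (size q <= n)%N -> remainder_pairing N q = 0.
  exact: H (leqnn N) q.
elim: n => [|n IH] nN {}q sq.
  have -> : q = 0 *: q by move: sq; rewrite leqn0 size_poly_eq0 => /eqP ->; rewrite scaler0.
  by rewrite remainder_pairingZ mul0r.
have bn := size_legendre_basis n.
have l0 : (legendre_basis n)`_n != 0.
  by have := lead_coef_eq0 (legendre_basis n); rewrite lead_coefE bn /= => ->; rewrite -size_poly_eq0 bn.
(* Subtracting this multiple of the basis element lowers the degree of [q]. *)
pose k := q`_n / (legendre_basis n)`_n.
have -> : q = k *: legendre_basis n + (q - k *: legendre_basis n) by rewrite addrC subrK.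
rewrite remainder_pairingD remainder_pairingZ remainder_pairing_basis// mulr0 add0r.
apply: IH; first exact: ltnW.
apply/leq_sizeP => j nj; rewrite coefB coefZ.
move: nj; rewrite leq_eqVlt => /predU1P[<-|nj].
  by rewrite /k divfK// subrr.
rewrite (leq_sizeP _ _ sq)// [X in _ * X]nth_default ?mulr0 ?subr0//.
by rewrite bn.
Qed.

(** Pythagoras: [h - p] is the sum of the remainder, which is orthogonal to
    polynomials of degree less than [N], and of such a polynomial. *)
Lemma sqint_best_approx N p : (size p <= N)%N ->
  (sqint (fun x => h x - (legendre_sum N).[x])%R <= sqint (fun x => h x - p.[x])%R)%E.
Proof.
move=> sp; set s := legendre_sum N.
have ss : (size s <= N)%N.
  rewrite /s /legendre_sum big_mkord; apply: (leq_trans (size_sum _ _ _)).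
  apply/bigmax_leqP => i _; apply: (leq_trans (size_scale_leq _ _)).
  by rewrite size_legendre_basis.
have [mr ir] := sq_integrableB Lh (sq_integrable_horner s).
have Lr := sq_integrableB Lh (sq_integrable_horner s).
have Lq := sq_integrable_horner (s - p).
have [mq iq] := Lq.
have i2 : mu.-integrable D (EFin \o (fun x => 2 * ((h x - s.[x]) * (s - p).[x]))).
  exact: (integrableZl _ 2 (integrable_mul Lr Lq)).
have -> : sqint (fun x => h x - p.[x]) =
    (\int[mu]_(x in D) (((h x - s.[x]) ^+ 2)%:E +
      ((2 * ((h x - s.[x]) * (s - p).[x]))%:E + ((s - p).[x] ^+ 2)%:E)))%E.
  apply: eq_integral => x _; rewrite -!EFinD; congr (_%:E).
  by rewrite hornerD hornerN; ring.
rewrite integralD//=; last exact: integrableD.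
rewrite integralD//=.
have -> : (\int[mu]_(x in D) (2 * ((h x - s.[x]) * (s - p).[x]))%:E = 0)%E.
  rewrite -[LHS]fineK ?integrable_fin_num//.
  rewrite -[fine _]/(Rintegral mu D (fun x => 2 * ((h x - s.[x]) * (s - p).[x]))).
  rewrite RintegralZl//; last exact: (integrable_mul Lr Lq).
  rewrite -/(remainder_pairing N (s - p)) remainder_pairing_eq0 ?mulr0//.
  by rewrite (leq_trans (size_polyD _ _))// geq_max ss size_polyN.
rewrite add0e leeDl// integral_ge0// => x _.
by rewrite lee_fin sqr_ge0.
Qed.

(** The partial sums do at least as well as any polynomial of smaller degree, and
    polynomials are dense. *)
Theorem legendre_sum_cvg :
  sqint (fun x => h x - (legendre_sum N).[x]) @[N --> \oo] --> 0%E.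
Proof.
have [mfh ih] := Lh.
have [_ Hp] := poly_approx_L2 mfh ih.
have F e : 0 < e -> \forall N \near \oo,
    (sqint (fun x => (h x - (legendre_sum N).[x])%R) < e%:E)%E.
  move=> /Hp[p pe]; exists (size p) => // N /= pN.
  exact: le_lt_trans (sqint_best_approx pN) pe.
apply/fine_cvgP; split.
  apply: filterS (F 1 ltr01) => N N1.
  by rewrite ge0_fin_numE ?sqint_ge0// (lt_trans N1)// ltry.
apply/cvgrPdist_lt => e e0; apply: filterS (F e e0) => N Ne.
rewrite sub0r normrN ger0_norm ?fine_ge0 ?sqint_ge0//.
by rewrite -lte_fin fineK// ge0_fin_numE ?sqint_ge0// (lt_trans Ne)// ltry.
Qed.

End legendre_completeness.

(** * The Mehler-Dirichlet integral *)

(** The integrand may be unbounded at both ends, as the Abel kernel is at its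
    singularity; only the antiderivative needs limits there.  Positivity permits
    passing to the limit along an increasing sequence of closed subintervals. *)
Lemma ge0_integral_oo_FTC (R : realType) (F f : R -> R) (a b A B : R) :
  a < b ->
  (forall x, a < x < b -> is_derive x (1 : R) F (f x)) ->
  (forall x, a < x < b -> {for x, continuous f}) ->
  (forall x, a < x < b -> 0 <= f x) ->
  F x @[x --> a^'+] --> A -> F x @[x --> b^'-] --> B ->
  (\int[@lebesgue_measure R]_(x in `]a, b[) (f x)%:E = (B - A)%:E)%E.
Proof.
move=> ab dF cf f0 FA FB.
(* The denominator [n + 3] makes [a + d n < b - d n] for every [n]. *)
pose d n : R := (b - a) / (n.+3)%:R.
have ba0 : 0 < b - a by rewrite subr_gt0.
have d0 n : 0 < d n by rewrite divr_gt0// ltr0n.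
have d3 n : d n * 2 < b - a.
  rewrite /d mulrAC ltr_pdivrMr ?ltr0n// ltr_pM2l// ltr_nat; lia.
have dn m n : (m <= n)%N -> d n <= d m.
  by move=> mn; rewrite /d ler_pM2l// lef_pV2 ?posrE ?ltr0n// ler_nat; lia.
have dcvg : d @ \oo --> 0.
  rewrite -(mulr0 (b - a)); apply: cvgM; first exact: cvg_cst.
  rewrite (_ : (fun n => _) = [sequence harmonic (n + 2)%N]_n); last first.
    by apply/funext => n; rewrite /harmonic /= addn2.
  by rewrite (cvg_shiftn 2 (harmonic : R^nat)); exact: cvg_harmonic.
pose S n : set R := `[a + d n, b - d n]%classic.
have Ssub n x : x \in `[a + d n, b - d n] -> a < x < b.
  by rewrite in_itv/= => /andP[ax xb]; have := d0 n; lra.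
have SU : \bigcup_n S n = `]a, b[%classic.
  apply/seteqP; split => [x [n _] /Ssub|x /=]; rewrite ?in_itv//=.
  move=> /andP[ax xb].
  have m0 : 0 < Num.min (x - a) (b - x) by rewrite lt_min !subr_gt0 ax xb.
  have : \forall n \near \oo, d n < Num.min (x - a) (b - x).
    exact: (cvgr_lt 0 dcvg).
  move=> [N _ /(_ N (leqnn N))] /=; rewrite lt_min => /andP[? ?].
  by exists N => //; rewrite /S /= in_itv/=; lra.
have mS (n : nat) : measurable (S n) by exact: measurable_itv.
have cS n : {within `[a + d n, b - d n], continuous f}.
  by apply: continuous_in_subspaceT => x; rewrite inE => /Ssub; exact: cf.
rewrite -SU.
have C : (\int[@lebesgue_measure R]_(x in S n) (f x)%:E)%E @[n --> \oo] -->
    (\int[@lebesgue_measure R]_(x in \bigcup_n S n) (f x)%:E)%E.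
  apply: ge0_nondecreasing_set_cvg_integral => //.
  - move=> m n mn; rewrite subsetEset => x; rewrite /S /= !in_itv/= => /andP[? ?].
    by have := dn _ _ mn; lra.
  - move=> n; apply/measurable_EFinP; apply: subspace_continuous_measurable_fun ; [exact: mS|exact: cS].
  - by move=> n x /Ssub; rewrite lee_fin; exact: f0.
have cF x : a < x < b -> {for x, continuous F}.
  by move=> /dF [xF _]; exact/differentiable_continuous/derivable1_diffP.
have E n : (\int[@lebesgue_measure R]_(x in S n) (f x)%:E =
    (F (b - d n) - F (a + d n))%:E)%E.
  rewrite (@continuous_FTC2 _ f F)//.
  - by have := d3 n; lra.
  - split.
    + by move=> x xn; apply: ex_derive; apply: dF; apply: (Ssub n); exact: subset_itv_oo_cc.
    + apply: cvg_at_right_filter; apply: cF; apply: (Ssub n).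
      by rewrite in_itv/= lexx /=; have := d3 n; lra.
    + apply: cvg_at_left_filter; apply: cF; apply: (Ssub n).
      by rewrite in_itv/= lexx andbT; have := d3 n; lra.
  - move=> x xn; rewrite derive1E.
    by apply: derive_val; apply: dF; apply: (Ssub n); exact: subset_itv_oo_cc.
move: C; under eq_fun do rewrite E.
move=> C; apply: (cvg_unique _ C); first exact: ereal_hausdorff.
apply: cvg_EFin; first exact: nearW.
apply: cvgB.
- apply: ((cvg_at_leftP F b B).1 FB (fun n => b - d n)); split.
    by move=> n; have := d0 n; lra.
  by rewrite -[X in _ --> X]subr0; apply: cvgB => //; exact: cvg_cst.
- apply: ((cvg_at_rightP F a A).1 FA (fun n => a + d n)); split.
    by move=> n; have := d0 n; lra.
  by rewrite -[X in _ --> X]addr0; apply: cvgD => //; exact: cvg_cst.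
Qed.

(** An antiderivative of [v^(2k) / sqrt (c^2 - v^2)], obtained by integrating by
    parts repeatedly. *)
Fixpoint asin_moment (R : realType) (c : R) (k : nat) (v : R) : R :=
  if k is j.+1 then
    ((j.*2.+1)%:R * c ^+ 2 * asin_moment c j v
     - v ^+ j.*2.+1 * Num.sqrt (c ^+ 2 - v ^+ 2)) / (j.*2.+2)%:R
  else asin (v / c).

Section asin_moment.
Variables (R : realType) (c : R) (c0 : 0 < c).

Lemma is_derive_asin_moment k v : - c < v < c ->
  is_derive v (1 : R) (asin_moment c k) (v ^+ k.*2 / Num.sqrt (c ^+ 2 - v ^+ 2)).
Proof.
move=> /andP[cv vc].
have q0 : 0 < c ^+ 2 - v ^+ 2 by rewrite subr_sqr; apply: mulr_gt0; lra.
have s0 : 0 < Num.sqrt (c ^+ 2 - v ^+ 2) by rewrite sqrtr_gt0.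
have s2 : Num.sqrt (c ^+ 2 - v ^+ 2) ^+ 2 = c ^+ 2 - v ^+ 2 by rewrite sqr_sqrtr// ltW.
elim: k => [|k IH].
  rewrite /asin_moment expr0 mul1r.
  have vc1 : -1 < v / c < 1 by rewrite ltr_pdivlMr// ltr_pdivrMr// mulN1r mul1r cv.
  have D := @is_derive1_comp _ (@asin R) (fun w => w / c) v _ _ (is_derive1_asin vc1) _.
  have Dv : is_derive v (1 : R) (fun w : R => w / c) c^-1.
    by apply: is_derive_eq; rewrite /GRing.scale /=; ring.
  have {Dv}D := D _ Dv; apply: is_derive_eq.
  have -> : 1 - (v / c) ^+ 2 = (c ^+ 2 - v ^+ 2) / c ^+ 2.
    by field; rewrite gt_eqF.
  rewrite sqrtrM ?ltW// sqrtrV ?exprn_ge0 ?ltW// sqrtr_sqr gtr0_norm//.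
  by field; rewrite !gt_eqF.
have Dq : is_derive v (1 : R) (fun w : R => c ^+ 2 - w ^+ 2) (- (2 * v)).
  by apply: is_derive_eq; rewrite /GRing.scale /=; ring.
have Ds := @is_derive1_comp _ (@Num.sqrt R) (fun w : R => c ^+ 2 - w ^+ 2) v _ _ (is_derive1_sqrt q0) Dq.
have -> : asin_moment c k.+1 = ((k.*2.+2)%:R^-1 *: ((k.*2.+1)%:R * c ^+ 2 *: asin_moment c k
     - (fun v => v ^+ k.*2.+1) * (@Num.sqrt R \o (fun v => (c ^+ 2 - v ^+ 2))))).
  by apply/funext => w; rewrite /= !fctE /GRing.scale /= mulrC.
have Dx : is_derive v (1 : R) (fun v : R => v ^+ k.*2.+1) (k.*2.+1%:R * v ^+ k.*2).
  have := is_deriveX k.*2.+1 (is_derive_id v (1 : R)); rewrite /GRing.scale /= mulr1 exprfctE; exact.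
have D := is_deriveZ (k.*2.+2%:R^-1) (is_deriveB (is_deriveZ (k.*2.+1%:R * c ^+ 2) IH) (is_deriveM Dx Ds)).
apply: (is_derive_eq D).
rewrite /GRing.scale /= doubleS.
set s := Num.sqrt _ in s0 s2 *.
have sn0 : s != 0 by rewrite gt_eqF.
apply: (mulIf sn0); rewrite divfK//.
have -> : c ^+ 2 = s ^+ 2 + v ^+ 2 by rewrite s2 subrK.
have N2 : k.*2%:R + 2 != 0 :> R by rewrite -natrD pnatr_eq0 addn2.
have -> : k.*2.+2%:R = k.*2%:R + 2 :> R by rewrite -addn2 natrD.
rewrite -[k.*2.+2]addn2 -natr1 exprD [v ^+ k.*2.+1]exprS.
by field; rewrite sn0 N2.
Qed.

Lemma asin_moment0 k : asin_moment c k 0 = 0.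
Proof.
elim: k => [|k IH] /=; last by rewrite IH expr0n /= mul0r mulr0 subr0 mul0r.
rewrite mul0r -[X in asin X]sin0 sinK// in_itv/= oppr_le0.
by rewrite andbb divr_ge0// pi_ge0.
Qed.

(** The value of [asin_moment] at [v = c], where it is not differentiable; the
    square root vanishes there, and Wallis' recurrence remains. *)
Fixpoint asin_moment_top (k : nat) : R :=
  if k is j.+1 then (j.*2.+1)%:R * c ^+ 2 * asin_moment_top j / (j.*2.+2)%:R
  else pi / 2.

Lemma asin_moment_topE k :
  asin_moment_top k = pi / 2 * (c ^+ 2) ^+ k * ('C(k.*2, k)%:R / 4 ^+ k).
Proof.
elim: k => [|k IH] /=; first by rewrite bin0 !expr0 invr1 !mulr1.
rewrite {}IH !exprS doubleS.
have /(congr1 (fun m => m%:R : R)) E4 := mul_bin_diag k.*2.+1.+1 k.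
have /(congr1 (fun m => m%:R : R)) E5 := mul_bin_down k.*2.+1 k.
move: E4 E5; rewrite !succnK.
have -> : (k.*2.+1 - k = k.+1)%N by rewrite -addnn; lia.
rewrite !natrM => E4 E5.
have k1 : k.+1%:R != 0 :> R by rewrite pnatr_eq0.
have -> : 'C(k.*2.+2, k.+1)%:R = 2 * (k.*2.+1%:R * 'C(k.*2, k)%:R / k.+1%:R) :> R.
  apply: (mulfI k1); rewrite -E4 E5 -doubleS -mul2n natrM; field.
  by rewrite ?nat1r ?natr1 k1.
have -> : k.*2.+2%:R = 2 * k.+1%:R :> R by rewrite -doubleS -mul2n natrM.
by field; rewrite expf_neq0//= nat1r k1.
Qed.

(** Left continuity of [asin] at [1], from the monotonicity of [sin]. *)
Lemma asin_cvg1 : @asin R u @[u --> 1^'-] --> pi / 2.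
Proof.
apply/cvgrPdist_lt => e e0.
(* The minimum keeps [pi / 2 - d] in the interval where [sin] is increasing. *)
pose d := Num.min e (pi / 2).
have p0 := pi_gt0 R.
have d0 : 0 < d by rewrite lt_min e0 divr_gt0.
have de : d <= e by rewrite ge_min lexx.
have dp : d <= pi / 2 by rewrite ge_min lexx orbT.
have sd : sin (pi / 2 - d) < 1.
  by rewrite -[ltRHS]sin_pihalf ltr_sin ?in_itv/=; lra.
near=> u.
have u1 : u < 1 by near: u; exact: nbhs_left_lt.
have u0 : 0 < u by near: u; exact: nbhs_left_gt.
have uB : -1 <= u <= 1 by lra.
have up := asin_lepi2 uB.
rewrite ger0_norm ?subr_ge0// ltrBlDr -ltrBlDl.
suff : pi / 2 - d < asin u by lra.
rewrite -ltr_sin ?in_itv/= ?up ?asin_geNpi2//; last by lra.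
rewrite asinK ?in_itv/= ?uB//.

Unshelve. all: by end_near. Qed.

Lemma asin_moment_cvg (T : Type) (F : set_system T) (FF : Filter F) (v : T -> R) k :
  v x @[x --> F] --> c -> (\forall x \near F, v x < c) ->
  asin_moment c k (v x) @[x --> F] --> asin_moment_top k.
Proof.
move=> vc vlt; elim: k => [|k IH] /=.
  have H : v x / c @[x --> F] --> 1^'-.
    move=> A /= [e /= e0 eA].
    have : v x / c @[x --> F] --> (1 : R).
      by rewrite -[X in _ --> X](divff (lt0r_neq0 c0)); apply: cvgM; [exact: vc|exact: cvg_cst].
    move=> /cvgrPdist_lt /(_ _ e0) H1.
    apply: (filterS2 _ _ H1 vlt) => x /= xe xc; apply: eA => //.
    by rewrite ltr_pdivrMr// mul1r.
  exact: cvg_comp H asin_cvg1.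
apply: cvgM; last exact: cvg_cst.
rewrite -[X in _ --> X]subr0; apply: cvgB.
  by apply: cvgM; [exact: cvg_cst|].
rewrite -[X in _ --> X](mulr0 (c ^+ k.*2.+1)); apply: cvgM.
  exact: (continuous_cvg _ (@exprn_continuous R k.*2.+1 c) vc).
rewrite -sqrtr0; apply: (continuous_cvg _ (@sqrt_continuous R 0)).
rewrite -[X in _ --> X](subrr (c ^+ 2)); apply: cvgB; first exact: cvg_cst.
exact: (continuous_cvg _ (@exprn_continuous R 2 c) vc).
Unshelve. all: by end_near. Qed.

End asin_moment.

(** With [a = t / 2], the recurrence of [dirichlet_poly] is the addition formula
    [sin ((2n + 5) a) = 2 cos (2a) sin ((2n + 3) a) - sin ((2n + 1) a)]. *)
Lemma sin_half_dirichlet (R : realType) (n : nat) (t : R) :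
  sin ((n%:R + 2^-1) * t) =
  sin (t / 2) * (dirichlet_poly R n).[(2 * cos (t / 2)) ^+ 2].
Proof.
pose a := t / 2.
have aE m : (m%:R + 2^-1) * t = (m.*2.+1)%:R * a.
  by rewrite /a -(natr1 m.*2) -mul2n natrM; field.
suff : sin ((n.*2.+1)%:R * a) = sin a * (dirichlet_poly R n).[(2 * cos a) ^+ 2]
  /\ sin ((n.+1.*2.+1)%:R * a) = sin a * (dirichlet_poly R n.+1).[(2 * cos a) ^+ 2].
  by rewrite aE => -[].
have S2 : sin (a + a) = 2 * sin a * cos a by rewrite sinD; ring.
have C2 : cos (a + a) = 2 * cos a ^+ 2 - 1.
  by rewrite cosD -!expr2 sin2cos2; ring.
elim: n => [|n [IH0 IH1]].
  rewrite dirichlet_poly0 dirichlet_poly1 -polyC1 !(hornerD, hornerN, hornerX, hornerC) mul1r mulr1; split => //.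
  have -> : (1.*2.+1)%:R * a = a + a + a by rewrite (_ : 1.*2.+1 = 3)%N//; ring.
  by rewrite sinD S2 C2; ring.
split=> //; rewrite dirichlet_poly_rec.
have -> : (n.+2.*2.+1)%:R * a = (n.+1.*2.+1)%:R * a + (a + a).
  by rewrite doubleS -addn2 natrD; ring.
have E : sin ((n.+1.*2.+1)%:R * a - (a + a)) = sin (n.*2.+1%:R * a).
  by congr sin; rewrite doubleS -addn2 natrD; ring.
move: E; rewrite sinB (sinD (_ * a)) hornerD hornerN hornerM hornerD hornerN hornerX hornerC.
rewrite IH0 => E.
transitivity (2 * cos (a + a) * sin (n.+1.*2.+1%:R * a) -
 (sin (n.+1.*2.+1%:R * a) * cos (a + a) - cos (n.+1.*2.+1%:R * a) * sin (a + a))).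
  by ring.
by rewrite E IH1 C2; ring.
Qed.

Section kernel_moment.
Variables (R : realType).
Notation mu := (@lebesgue_measure R).

Lemma sin2_half_gt (y t : R) : 0 < y < 1 -> 0 < t < pi ->
  (y < sin (t / 2) ^+ 2) = (2 * acos (Num.sqrt (1 - y)) < t).
Proof.
move=> /andP[y0 y1] /andP[t0 tpi].
have c01 : 0 <= Num.sqrt (1 - y) <= 1.
  by rewrite sqrtr_ge0 -[leRHS]sqrtr1 ler_sqrt//; lra.
have th : 0 <= t / 2 <= pi by lra.
have ch : 0 <= cos (t / 2) by apply: cos_ge0_pihalf; lra.
transitivity (cos (t / 2) < Num.sqrt (1 - y)).
  have -> : cos (t / 2) = Num.sqrt (cos (t / 2) ^+ 2) by rewrite sqrtr_sqr ger0_norm.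
  by rewrite ltr_sqrt ?subr_gt0// cos2sin2; lra.
rewrite -{1}[Num.sqrt (1 - y)]acosK ?in_itv/=; last by lra.
rewrite ltr_cos ?in_itv/= ?acos_ge0 ?acos_lepi//; try lra.
Qed.

(** Where [sin (t/2) ^ 2 <= y] the square root is [0], and so is its inverse: the
    integral is in fact over [sin (t/2) ^ 2 > y].  With [v = cos (t/2)] and
    [c ^ 2 = 1 - y], the integrand is the derivative of
    [- 2 asin_moment c k (cos (t/2))]. *)
Lemma abel_kernel_moment (y : R) (k : nat) : 0 < y < 1 ->
  (\int[mu]_(t in `]0%R, pi[)
    (sin (t / 2) * cos (t / 2) ^+ k.*2 / Num.sqrt (sin (t / 2) ^+ 2 - y))%:E =
  (pi * (1 - y) ^+ k * ('C(k.*2, k)%:R / 4 ^+ k))%:E)%E.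
Proof.
move=> y01; have /andP[y0 y1] := y01.
set c := Num.sqrt (1 - y).
have c0 : 0 < c by rewrite sqrtr_gt0 subr_gt0.
have c1 : c < 1 by rewrite -[ltRHS]sqrtr1 ltr_sqrt//; lra.
have c2 : c ^+ 2 = 1 - y by rewrite sqr_sqrtr//; lra.
pose th := 2 * acos c.
have cB : -1 <= c <= 1 by lra.
have th0 : 0 < th by rewrite mulr_gt0// acos_gt0//; lra.
have cth : cos (th / 2) = c.
  by rewrite /th mulrAC divff// mul1r acosK// in_itv.
have thpi : th < pi.
  rewrite -ltr_pdivlMl// mulrC -ltr_cos ?in_itv/= ?acos_ge0 ?acos_lepi//; last first.
    by have := pi_gt0 R; lra.
  by rewrite cos_pihalf acosK ?in_itv.
transitivity (\int[mu]_(t in `]th, pi[)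
    (sin (t / 2) * cos (t / 2) ^+ k.*2 / Num.sqrt (sin (t / 2) ^+ 2 - y))%:E)%E.
  rewrite [LHS]integral_mkcond [RHS]integral_mkcond; apply: eq_integral => t _.
  rewrite !patchE !mem_setE !in_itv/=; case: (boolP (0 < t < pi)) => t0; last first.
    by case: ifPn => // tth; exfalso; move: t0; apply/negP/negPn; lra.
  case: ifPn => // nt.
  rewrite ler0_sqrtr ?invr0 ?mulr0// subr_le0 leNgt sin2_half_gt//.
  by apply/negP => tt; move: nt; apply/negP/negPn; rewrite tt; lra.
pose F (t : R) := - 2 * asin_moment c k (cos (t / 2)).
have cpos t : th < t < pi -> 0 < cos (t / 2) < c.
  move=> tt; rewrite cos_gt0_pihalf; last by lra.
  by rewrite -cth ltr_cos ?in_itv/=; lra.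
have dc (t : R) : is_derive t (1 : R) (fun t => cos (t / 2)) (- (sin (t / 2) / 2)).
  have D0 : is_derive t (1 : R) (fun t : R => t / 2) 2^-1.
    by apply: is_derive_eq; rewrite /GRing.scale /=; ring.
  have D := @is_derive1_comp _ (@cos R) (fun t => t / 2) t _ _ (is_derive_cos _) D0.
  by apply: (is_derive_eq D); ring.
have cont_c : continuous (fun t : R => cos (t / 2)).
  by move=> t; have [dt _] := dc t; exact/differentiable_continuous/derivable1_diffP.
have cont_s : continuous (fun t : R => sin (t / 2)).
  move=> t; apply: continuous_comp; last exact: continuous_sin.
  by apply: continuousM; [exact: cvg_id|exact: cvg_cst].
have sE t : sin (t / 2) ^+ 2 - y = c ^+ 2 - cos (t / 2) ^+ 2.
  by rewrite c2 sin2cos2; ring.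
have qpos t : th < t < pi -> 0 < c ^+ 2 - cos (t / 2) ^+ 2.
  by move=> /cpos ?; rewrite subr_sqr mulr_gt0//; lra.
transitivity ((F pi - (- 2 * asin_moment_top c k))%:E); last first.
  congr (_%:E); rewrite /F cos_pihalf asin_moment0 (asin_moment_topE c0) c2; field.
  by rewrite expf_neq0.
apply: (@ge0_integral_oo_FTC _ F) => //.
- move=> t tt; have vt := cpos _ tt.
  have vB : - c < cos (t / 2) < c by lra.
  have D := is_deriveZ (- 2) (@is_derive1_comp _ (asin_moment c k) (fun t => cos (t / 2)) t _ _
    (is_derive_asin_moment c0 k vB) (dc t)).
  apply: (is_derive_eq D); rewrite sE /GRing.scale /=; field.
  by rewrite gt_eqF// sqrtr_gt0 qpos.
- move=> t tt; apply: cvgM.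
    apply: cvgM; first exact: cont_s.
    exact: (continuous_cvg _ (@exprn_continuous R k.*2 _) (cont_c t)).
  apply: cvgV; first by rewrite gt_eqF// sqrtr_gt0 sE qpos.
  apply: (continuous_cvg _ (@sqrt_continuous R _)).
  apply: cvgB; last exact: cvg_cst.
  exact: (continuous_cvg _ (@exprn_continuous R 2 _) (cont_s t)).
- move=> t tt; rewrite divr_ge0 ?sqrtr_ge0// mulr_ge0//.
    by apply: sin_ge0_pi; lra.
  by rewrite exprn_ge0//; have := cpos _ tt; lra.
- apply: cvgM; first exact: cvg_cst.
  apply: asin_moment_cvg => //.
    by rewrite -[X in _ --> X]cth; apply: cvg_at_right_filter; exact: cont_c.
  near=> t; have /cpos : th < t < pi by apply/andP; split; near: t; [exact: nbhs_right_gt|exact: nbhs_right_lt].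
  by move=> /andP[].
- apply: cvgM; first exact: cvg_cst.
  apply: cvg_at_left_filter; apply: (continuous_cvg _ _ (cont_c pi)).
  have vB : - c < cos (pi / 2) < c by rewrite cos_pihalf; lra.
  by have [dt _] := is_derive_asin_moment c0 k vB; exact/differentiable_continuous/derivable1_diffP.
Unshelve. all: by end_near. Qed.

End kernel_moment.

(** * Fubini for the Abel kernel *)

Section measurability.
Context d (T : measurableType d) (R : realType).

(** The function [powR] with exponent [-1] is measurable, and it takes the value
    [0] at [0], as the inverse does. *)
Lemma measurable_fun_inv_sqrt (D : set T) (u : T -> R) :
  measurable_fun D u -> measurable_fun D (fun x => (Num.sqrt (u x))^-1).
Proof.
move=> mu; rewrite (_ : (fun _ => _) = (@powR R ^~ (-1)) \o (@Num.sqrt R) \o u).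
  apply: measurableT_comp => //; apply: measurableT_comp.
    exact: measurable_powR.
  exact: continuous_measurable_fun (@sqrt_continuous R).
by apply/funext => x /=; rewrite powR_inv1// sqrtr_ge0.
Qed.

Lemma integral_indicM (mu : {measure set T -> \bar R}) (A : set T) (g : T -> R) :
  (\int[mu]_t (\1_A t * g t)%:E = \int[mu]_(t in A) (g t)%:E)%E.
Proof.
rewrite [RHS]integral_mkcond; apply: eq_integral => t _.
by rewrite patchE indicE; case: (t \in A); rewrite ?mul1r ?mul0r.
Qed.

End measurability.

Lemma measurable_sinM (R : realType) (a : R) :
  measurable_fun setT (fun t : R => sin (a * t)).
Proof.
apply: continuous_measurable_fun => t; apply: continuous_comp; last exact: continuous_sin.
by apply: continuousM; [exact: cvg_cst|exact: cvg_id].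
Qed.

Lemma measurable_cosM (R : realType) (a : R) :
  measurable_fun setT (fun t : R => cos (a * t)).
Proof.
apply: continuous_measurable_fun => t; apply: continuous_comp; last exact: continuous_cos.
by apply: continuousM; [exact: cvg_cst|exact: cvg_id].
Qed.

Section kernel_integrals.
Variable R : realType.
Notation mu := (@lebesgue_measure R).

Lemma integral_inv_sqrtl (x : R) : 0 < x ->
  (\int[mu]_(y in `]0%R, x[) ((Num.sqrt (x - y))^-1)%:E = (2 * Num.sqrt x)%:E)%E.
Proof.
move=> x0; pose F y := - 2 * Num.sqrt (x - y).
have cF : continuous F.
  move=> y; apply: cvgM; first exact: cvg_cst.
  apply: (continuous_cvg _ (@sqrt_continuous R _)).
  by apply: cvgB; [exact: cvg_cst|exact: cvg_id].
transitivity ((F x - F 0)%:E); last first.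
  by congr (_%:E); rewrite /F subrr sqrtr0 subr0; ring.
apply: (@ge0_integral_oo_FTC _ F) => //.
- move=> y /andP[_ yx]; have q0 : 0 < x - y by rewrite subr_gt0.
  have D0 : is_derive y (1 : R) (fun y : R => x - y) (- 1).
    by apply: is_derive_eq; rewrite /GRing.scale /=; ring.
  have D := is_deriveZ (- 2) (@is_derive1_comp _ (@Num.sqrt R) (fun y => x - y) y _ _
    (is_derive1_sqrt q0) D0).
  apply: (is_derive_eq D); rewrite /GRing.scale /=; field.
  by rewrite gt_eqF// sqrtr_gt0.
- move=> y /andP[_ yx]; apply: cvgV; first by rewrite gt_eqF// sqrtr_gt0 subr_gt0.
  apply: (continuous_cvg _ (@sqrt_continuous R _)).
  by apply: cvgB; [exact: cvg_cst|exact: cvg_id].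
- exact/cvg_at_right_filter/cF.
- exact/cvg_at_left_filter/cF.
Qed.

Lemma integral_inv_sqrtr (y : R) : 0 < y < 1 ->
  (\int[mu]_(x in `]0%R, 1%R[) ((Num.sqrt (x - y))^-1)%:E = (2 * Num.sqrt (1 - y))%:E)%E.
Proof.
move=> /andP[y0 y1].
transitivity (\int[mu]_(x in `]y, 1%R[) ((Num.sqrt (x - y))^-1)%:E)%E.
  rewrite [LHS]integral_mkcond [RHS]integral_mkcond; apply: eq_integral => t _.
  rewrite !patchE !mem_setE !in_itv/=; case: (boolP (0 < t < 1)) => t0; last first.
    by case: ifPn => // tth; exfalso; move: t0; apply/negP/negPn; lra.
  case: ifPn => // nt.
  rewrite ler0_sqrtr ?invr0// subr_le0 leNgt.
  by apply/negP => tt; move: nt; apply/negP/negPn; rewrite tt; lra.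
pose F x := 2 * Num.sqrt (x - y).
have cF : continuous F.
  move=> x; apply: cvgM; first exact: cvg_cst.
  apply: (continuous_cvg _ (@sqrt_continuous R _)).
  by apply: cvgB; [exact: cvg_id|exact: cvg_cst].
transitivity ((F 1 - F y)%:E); last first.
  by congr (_%:E); rewrite /F subrr sqrtr0 mulr0 subr0.
apply: (@ge0_integral_oo_FTC _ F) => //.
- move=> x /andP[yx _]; have q0 : 0 < x - y by rewrite subr_gt0.
  have D0 : is_derive x (1 : R) (fun x : R => x - y) 1.
    by apply: is_derive_eq; rewrite /GRing.scale /=; ring.
  have D := is_deriveZ 2 (@is_derive1_comp _ (@Num.sqrt R) (fun x => x - y) x _ _
    (is_derive1_sqrt q0) D0).
  apply: (is_derive_eq D); rewrite /GRing.scale /=; field.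
  by rewrite gt_eqF// sqrtr_gt0.
- move=> x /andP[yx _]; apply: cvgV; first by rewrite gt_eqF// sqrtr_gt0 subr_gt0.
  apply: (continuous_cvg _ (@sqrt_continuous R _)).
  by apply: cvgB; [exact: cvg_id|exact: cvg_cst].
- exact/cvg_at_right_filter/cF.
- exact/cvg_at_left_filter/cF.
Qed.

End kernel_integrals.

(** The kernel vanishes for [y >= x], so that the upper limit [x] of the Abel
    transform can be replaced by one that does not depend on [x], as Fubini's
    theorem requires. *)
Lemma integral_abel_kernel_support (R : realType) (g : R -> R) (x : R) : x <= 1 ->
  (\int[@lebesgue_measure R]_(y in `]0%R, 1%R[) (g y / Num.sqrt (x - y))%:E =
   \int[@lebesgue_measure R]_(y in `]0%R, x[) (g y / Num.sqrt (x - y))%:E)%E.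
Proof.
move=> x1; rewrite [LHS]integral_mkcond [RHS]integral_mkcond.
apply: eq_integral => y _; rewrite !patchE !mem_setE !in_itv/=.
have [y0|] := boolP (0 < y); last by [].
have [yx|xy] := ltP y x; first by rewrite (lt_le_trans yx).
by case: ifPn => //= _; rewrite ler0_sqrtr ?subr_le0// invr0 mulr0.
Qed.

Section abel_fubini.
Variables (R : realType) (h : R -> R).
Notation mu := (@lebesgue_measure R).
Hypothesis mh : measurable_fun setT h.
Hypothesis h0 : forall y, ~~ (0 < y < 1) -> h y = 0.
Hypothesis ih2 : mu.-integrable setT (fun y => (h y ^+ 2)%:E).

(** The integrand of the double integral, in the variables [t] and [y], extended
    by [0] outside [0 < t < pi]. *)
Definition abel_weight (t y : R) : R :=
  \1_`]0, pi[ t * (h y / Num.sqrt (sin (t / 2) ^+ 2 - y)).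

Lemma measurable_sin_half : measurable_fun setT (fun t : R => sin (t / 2)).
Proof.
by have := @measurable_sinM R 2^-1; congr (measurable_fun _ _); apply/funext => t; rewrite mulrC.
Qed.

Lemma measurable_abel_kernel :
  measurable_fun setT (fun z : R * R => (Num.sqrt (sin (z.1 / 2) ^+ 2 - z.2))^-1).
Proof.
apply: measurable_fun_inv_sqrt; apply: measurable_funB; last exact: measurable_snd.
apply: measurable_funX.
exact: (measurableT_comp measurable_sin_half measurable_fst).
Qed.

Lemma measurable_indic_fst (A : set R) : measurable A ->
  measurable_fun setT (fun z : R * R => \1_A z.1 : R).
Proof.
by move=> mA; apply: (measurableT_comp (measurable_indic _) measurable_fst).
Qed.

Lemma measurable_indic_snd (A : set R) : measurable A ->
  measurable_fun setT (fun z : R * R => \1_A z.2 : R).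
Proof.
by move=> mA; apply: (measurableT_comp (measurable_indic _) measurable_snd).
Qed.

Lemma measurable_abel_weight :
  measurable_fun setT (fun z : R * R => abel_weight z.1 z.2).
Proof.
apply: measurable_funM; first exact: measurable_indic_fst.
apply: measurable_funM; last exact: measurable_abel_kernel.
exact: (measurableT_comp mh measurable_snd).
Qed.

Let F1 (z : R * R) := \1_`]0, pi[ z.1 *
  (sin (z.1 / 2) / Num.sqrt (sin (z.1 / 2) ^+ 2 - z.2)) * h z.2 ^+ 2.
Let F2 (z : R * R) := \1_`]0, pi[ z.1 * ((Num.sqrt (sin (z.1 / 2) ^+ 2))^-1 *
  (\1_`]0, 1[ z.2 / Num.sqrt (sin (z.1 / 2) ^+ 2 - z.2))).

Let sin_half_gt0 (t : R) : 0 < t < pi -> 0 < sin (t / 2).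
Proof. by move=> t0; apply: sin_gt0_pi; lra. Qed.

Let K1_ge0 (t y : R) : 0 <= \1_`]0, pi[ t * (sin (t / 2) / Num.sqrt (sin (t / 2) ^+ 2 - y)).
Proof.
rewrite indicE mem_setE in_itv/=; case: (boolP (0 < t < pi)) => [t0|_]; last by rewrite !mul0r.
by rewrite mul1r divr_ge0 ?sqrtr_ge0// ltW// sin_half_gt0.
Qed.

Let F1_ge0 z : 0 <= F1 z.
Proof. by rewrite /F1 mulr_ge0 ?sqr_ge0. Qed.

Let F2_ge0 z : 0 <= F2 z.
Proof. by rewrite /F2 !indicE mulr_ge0// mulr_ge0 ?invr_ge0 ?sqrtr_ge0// divr_ge0 ?sqrtr_ge0. Qed.

Let mF1 : measurable_fun setT F1.
Proof.
apply: measurable_funM.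
  apply: measurable_funM; first exact: measurable_indic_fst.
  apply: measurable_funM; last exact: measurable_abel_kernel.
  exact: (measurableT_comp measurable_sin_half measurable_fst).
by apply: measurable_funX; exact: (measurableT_comp mh measurable_snd).
Qed.

Let mF2 : measurable_fun setT F2.
Proof.
apply: measurable_funM; first exact: measurable_indic_fst.
apply: measurable_funM; last first.
  apply: measurable_funM; last exact: measurable_abel_kernel.
  exact: measurable_indic_snd.
apply: measurable_fun_inv_sqrt; apply: measurable_funX.
exact: (measurableT_comp measurable_sin_half measurable_fst).
Qed.

Let iF1 : (mu \x mu)%E.-integrable setT (EFin \o F1).
Proof.
apply/integrable21ltyP; first exact/measurable_EFinP.
have E y : (\int[mu]_x `|(EFin \o F1) (x, y)| = pi%:E * (h y ^+ 2)%:E)%E.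
  under eq_integral do rewrite /= ger0_norm ?F1_ge0//.
  have [y01|/h0 y0] := boolP (0 < y < 1); last first.
    rewrite y0 expr0n mule0; apply: integral0_eq => t _.
    by rewrite /F1 /= y0 expr0n mulr0.
  rewrite /F1 /=; under eq_integral do rewrite EFinM.
  rewrite ge0_integralZr//; last 3 first.
  - apply/measurable_EFinP; apply: measurable_funM; first exact: measurable_indic.
    apply: measurable_funM; first exact: measurable_sin_half.
    apply: measurable_fun_inv_sqrt; apply: measurable_funB => //.
    exact: measurable_funX measurable_sin_half.
  - by move=> t _; rewrite lee_fin.
  - by rewrite lee_fin sqr_ge0.
  rewrite integral_indicM; congr (_ * _)%E.
  have := abel_kernel_moment 0 y01.
  rewrite bin0 !expr0 invr1 !mulr1 => <-.
  by apply: eq_integral => t _; rewrite mulr1.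
under eq_integral do rewrite E.
have /integrableP[_] := integrableZl measurableT pi ih2.
by under eq_integral do rewrite gee0_abs ?mule_ge0 ?lee_fin ?pi_ge0 ?sqr_ge0//.
Qed.

Let iF2 : (mu \x mu)%E.-integrable setT (EFin \o F2).
Proof.
apply/integrable12ltyP; first exact/measurable_EFinP.
have E t : (\int[mu]_y `|(EFin \o F2) (t, y)| = (\1_`]0, pi[ t * 2)%:E)%E.
  under eq_integral do rewrite /= ger0_norm ?F2_ge0//.
  rewrite /F2 /= indicE mem_setE in_itv/=.
  case: (boolP (0 < t < pi)) => [t0|_]; last first.
    by rewrite mul0r; apply: integral0_eq => y _; rewrite mul0r.
  have s0 := sin_half_gt0 t0.
  under eq_integral do rewrite mul1r EFinM.
  rewrite ge0_integralZl//; last first.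
    apply/measurable_EFinP; apply: measurable_funM; first exact: measurable_indic.
    by apply: measurable_fun_inv_sqrt; apply: measurable_funB.
  rewrite integral_indicM.
  have x0 : 0 < sin (t / 2) ^+ 2 by rewrite exprn_gt0.
  have x1 : sin (t / 2) ^+ 2 <= 1 by rewrite expr_le1// ?sin_le1// ltW.
  have := integral_abel_kernel_support (cst 1) x1.
  under [X in X = _]eq_integral do rewrite mul1r.
  move=> ->; under eq_integral do rewrite mul1r.
  rewrite integral_inv_sqrtl// sqrtr_sqr gtr0_norm// -EFinM; congr (_%:E).
  by rewrite /= mul1r; field; rewrite gt_eqF.
under eq_integral do rewrite E.
rewrite integral_indicM integral_cst//= lebesgue_measure_itv/= lte_fin pi_gt0.
by rewrite -EFinD -EFinM ltry.
Qed.

(** The inequality [|h| <= s h^2 + 1/s] with [s = sin (t/2)] splits the weight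
    into [F1], whose integral in [t] is [pi h(y)^2] by [abel_kernel_moment], and
    [F2], whose integral in [y] is [2].  The Cauchy-Schwarz inequality in [y]
    alone would not do, since the square of the kernel is not integrable. *)
Lemma integrable_abel_weight :
  (mu \x mu)%E.-integrable setT (fun z : R * R => (abel_weight z.1 z.2)%:E).
Proof.
apply: (le_integrable _ _ _ (integrableD _ iF1 iF2)) => //.
  by apply/measurable_EFinP; exact: measurable_abel_weight.
move=> [t y] _ /=; rewrite lee_fin [leRHS]ger0_norm ?addr_ge0//.
rewrite /abel_weight /F1 /F2 /= !indicE !mem_setE !in_itv/=.
case: (boolP (0 < t < pi)) => t0; last by rewrite !mul0r normr0 addr0.
case: (boolP (0 < y < 1)) => [y0|/h0 ->]; last first.
  by rewrite expr0n !(mul0r, mulr0) normr0 addr0.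
rewrite !mul1r; have s0 := sin_half_gt0 t0.
rewrite sqrtr_sqr (gtr0_norm s0).
set k := (Num.sqrt _)^-1; set s := sin _ in s0 *.
have k0 : 0 <= k by rewrite invr_ge0 sqrtr_ge0.
rewrite normrM (ger0_norm k0).
rewrite (_ : _ + _ = (s * h y ^+ 2 + s^-1) * k); last by ring.
rewrite ler_wpM2r// -(ler_pM2l s0) mulrDr divff ?gt_eqF//.
rewrite -[h y ^+ 2]real_normK ?num_real//.
by have := sqr_ge0 (s * `|h y| - 1); nra.
Qed.

End abel_fubini.

Section dirichlet_integral.
Variable R : realType.
Notation mu := (@lebesgue_measure R).

Lemma measurable_sin_over_kernel (y : R) (k : nat) :
  measurable_fun setT (fun t : R =>
    sin (t / 2) * cos (t / 2) ^+ k / Num.sqrt (sin (t / 2) ^+ 2 - y)).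
Proof.
apply: measurable_funM.
  apply: measurable_funM; first exact: measurable_sin_half.
  apply: measurable_funX.
  by have := @measurable_cosM R 2^-1; congr (measurable_fun _ _); apply/funext => t; rewrite mulrC.
apply: measurable_fun_inv_sqrt; apply: measurable_funB => //.
by apply: measurable_funX; exact: measurable_sin_half.
Qed.

Lemma integrable_abel_kernel_moment (y : R) (k : nat) : 0 < y < 1 ->
  mu.-integrable `]0, pi[ (fun t =>
    (sin (t / 2) * cos (t / 2) ^+ k.*2 / Num.sqrt (sin (t / 2) ^+ 2 - y))%:E).
Proof.
move=> y01; apply/integrableP; split.
  apply/measurable_EFinP; apply: measurable_funTS.
  exact: measurable_sin_over_kernel.
have := abel_kernel_moment k y01.
rewrite (_ : integral _ _ _ = (\int[mu]_(t in `]0%R, pi[)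
 `|(sin (t / 2) * cos (t / 2) ^+ k.*2 / Num.sqrt (sin (t / 2) ^+ 2 - y))%:E|)%E).
  by move=> ->; rewrite ltry.
apply: eq_integral => t; rewrite mem_setE in_itv/= => t0.
rewrite ger0_norm// divr_ge0 ?sqrtr_ge0// mulr_ge0//; last first.
  by rewrite -mul2n exprM exprn_ge0// sqr_ge0.
by apply: sin_ge0_pi; lra.
Qed.

Let dirichletE (n : nat) (y t : R) :
  sin ((n%:R + 2^-1) * t) / Num.sqrt (sin (t / 2) ^+ 2 - y) =
  \sum_(k < n.+1) (dirichlet_coef R n k * 4 ^+ k) *
    (sin (t / 2) * cos (t / 2) ^+ k.*2 / Num.sqrt (sin (t / 2) ^+ 2 - y)).
Proof.
rewrite sin_half_dirichlet horner_poly mulr_sumr mulr_suml; apply: eq_bigr => k _.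
rewrite -exprM exprMn mul2n (_ : 4 = 2 ^+ 2); last by ring.
by rewrite -exprM mul2n; ring.
Qed.

Let dirichletEF (n : nat) (y : R) :
  (fun t => (sin ((n%:R + 2^-1) * t) / Num.sqrt (sin (t / 2) ^+ 2 - y))%:E) =
  (fun t => \sum_(k < n.+1) ((dirichlet_coef R n k * 4 ^+ k) *
    (sin (t / 2) * cos (t / 2) ^+ k.*2 / Num.sqrt (sin (t / 2) ^+ 2 - y)))%:E)%E.
Proof. by apply/funext => t; rewrite dirichletE sumEFin. Qed.

Lemma integrable_sin_abel_kernel (n : nat) (y : R) : 0 < y < 1 ->
  mu.-integrable `]0, pi[ (fun t =>
    (sin ((n%:R + 2^-1) * t) / Num.sqrt (sin (t / 2) ^+ 2 - y))%:E).
Proof.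
move=> y01; rewrite (dirichletEF n y).
apply: integrable_sum => //= k _.
exact: (integrableZl _ _ (integrable_abel_kernel_moment k y01)).
Qed.

(** The Mehler-Dirichlet formula, by expanding [sin ((n + 1/2) t)] in powers of
    [cos (t/2)] and integrating term by term with [abel_kernel_moment]. *)
Lemma integral_sin_abel_kernel (n : nat) (y : R) : 0 < y < 1 ->
  (\int[mu]_(t in `]0%R, pi[)
    (sin ((n%:R + 2^-1) * t) / Num.sqrt (sin (t / 2) ^+ 2 - y))%:E
   = (pi * (slegendre R n).[1 - y])%:E)%E.
Proof.
move=> y01; rewrite (dirichletEF n y).
rewrite integral_sum//=; last first.
  by move=> k; exact: (integrableZl _ _ (integrable_abel_kernel_moment k y01)).
under eq_bigr => k _.
  under eq_integral do rewrite EFinM.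
  rewrite integralZl//; last exact: integrable_abel_kernel_moment.
  rewrite abel_kernel_moment// -EFinM.
  over.
rewrite sumEFin; congr (_%:E); rewrite horner_poly mulr_sumr.
apply: eq_bigr => k _; rewrite /slegendre_coef; field.
by rewrite expf_neq0.
Qed.

End dirichlet_integral.

Section abel_fubini_consequences.
Variables (R : realType) (h : R -> R).
Notation mu := (@lebesgue_measure R).
Hypothesis mh : measurable_fun setT h.
Hypothesis h0 : forall y, ~~ (0 < y < 1) -> h y = 0.
Hypothesis ih2 : mu.-integrable setT (fun y => (h y ^+ 2)%:E).

Let iW := integrable_abel_weight mh h0 ih2.

(** The Abel transform at [sin (t/2) ^ 2], written as a partial integral of
    [abel_weight] so that Fubini's theorem speaks of it. *)
Definition abel_at_sin2 (t : R) : R := fine (\int[mu]_y (abel_weight h t y)%:E)%E.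

Lemma integrable_abel_at_sin2 : mu.-integrable setT (EFin \o abel_at_sin2).
Proof.
have iE := integrable_fubini_F iW.
apply: (le_integrable _ _ _ iE) => //.
  apply/measurable_EFinP.
  exact: (measurableT_comp (fine_measurable measurableT) (measurable_int _ iE)).
move=> t _ /=; rewrite /abel_at_sin2 /fubini_F.
by case: integral => [r| |]//=; rewrite normr0 leey.
Qed.

Lemma abel_at_sin2E (t : R) : 0 < t < pi ->
  abel_at_sin2 t = Rintegral mu `]0, sin (t / 2) ^+ 2[
    (fun y => h y / Num.sqrt (sin (t / 2) ^+ 2 - y)).
Proof.
move=> t0; rewrite /abel_at_sin2 /Rintegral -integral_abel_kernel_support; last first.
  have st : 0 <= sin (t / 2) by apply: sin_ge0_pi; lra.
  by rewrite expr_le1// sin_le1.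
congr fine; rewrite [RHS]integral_mkcond; apply: eq_integral => y _.
rewrite patchE mem_setE /abel_weight indicE mem_setE !in_itv/= t0 mul1r.
by case: ifPn => // /h0 ->; rewrite mul0r.
Qed.

Lemma integrable_bounded_abel_at_sin2 (phi : R -> R) : measurable_fun setT phi ->
  (forall t, `|phi t| <= 1) ->
  mu.-integrable setT (fun t => (phi t * abel_at_sin2 t)%:E).
Proof.
move=> mphi phi1; apply: (le_integrable _ _ _ integrable_abel_at_sin2) => //.
  apply/measurable_EFinP; apply: measurable_funM => //.
  by apply/measurable_EFinP; exact: measurable_int integrable_abel_at_sin2.
move=> t _ /=; rewrite lee_fin normrM.
by rewrite -[leRHS]mul1r ler_wpM2r.
Qed.

(** The exchange of integrations, for a bounded [phi] whose integral against the
    kernel in the variable [t] is known for each [y]. *)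
Lemma Rintegral_abel_at_sin2 (phi kappa : R -> R) : measurable_fun setT phi ->
  (forall t, `|phi t| <= 1) ->
  (forall y, 0 < y < 1 -> mu.-integrable `]0, pi[ (fun t =>
    (phi t / Num.sqrt (sin (t / 2) ^+ 2 - y))%:E)) ->
  (forall y, 0 < y < 1 -> (\int[mu]_(t in `]0%R, pi[)
    (phi t / Num.sqrt (sin (t / 2) ^+ 2 - y))%:E = (kappa y)%:E)%E) ->
  Rintegral mu setT (fun t => phi t * abel_at_sin2 t) =
  Rintegral mu `]0, 1[ (fun y => h y * kappa y).
Proof.
move=> mphi phi1 ik kE.
have iphiW : (mu \x mu)%E.-integrable setT
    (fun z : R * R => (phi z.1 * abel_weight h z.1 z.2)%:E).
  apply: (le_integrable _ _ _ iW) => //.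
    apply/measurable_EFinP; apply: measurable_funM.
      exact: (measurableT_comp mphi measurable_fst).
    exact: measurable_abel_weight.
  move=> z _; rewrite lee_fin normrM -[leRHS]mul1r ler_wpM2r//.
congr fine.
(* The factor [phi t] enters the inner integral only where the latter converges,
   that is for almost every [t]. *)
transitivity (\int[mu]_t (\int[mu]_y (phi t * abel_weight h t y)%:E))%E.
  apply: ae_eq_integral => //.
  - by apply: measurable_int; apply: integrable_bounded_abel_at_sin2.
  - exact: (measurable_fubini_F iphiW).
  - have := ae_integrable1 iW; apply: filterS => t it _.
    under eq_integral do rewrite EFinM.
    rewrite integralZl// EFinM; congr (_ * _)%E.
    by rewrite /abel_at_sin2 fineK// integrable_fin_num.
transitivity (\int[mu]_y (\int[mu]_t (phi t * abel_weight h t y)%:E))%E.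
  exact: (Fubini iphiW).
rewrite [RHS]integral_mkcond; apply: eq_integral => y _.
rewrite patchE mem_setE in_itv/=; case: ifPn => [y01|/h0 y0]; last first.
  by apply: integral0_eq => t _; rewrite /abel_weight y0 !(mul0r, mulr0).
transitivity (\int[mu]_t (\1_`]0%R, pi[ t * (h y * (phi t / Num.sqrt (sin (t / 2) ^+ 2 - y))))%:E)%E.
  by apply: eq_integral => t _; congr (_%:E); rewrite /abel_weight; ring.
rewrite integral_indicM; under eq_integral do rewrite EFinM.
rewrite integralZl//; last exact: ik.
by rewrite kE.
Qed.

End abel_fubini_consequences.

(** By Tonelli's theorem: for fixed [y] the kernel has integral
    [2 sqrt (1 - y)] in [x], and [2 |h| sqrt (1 - y) <= h^2 + 1]. *)
Lemma ae_integrable_abel (R : realType) (h : R -> R) :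
  measurable_fun setT h -> (forall y, ~~ (0 < y < 1) -> h y = 0) ->
  (@lebesgue_measure R).-integrable setT (fun y => (h y ^+ 2)%:E) ->
  {ae @lebesgue_measure R, forall x : R, 0 <= x <= 1 ->
    (@lebesgue_measure R).-integrable `]0, x[
      (fun y => (h y / Num.sqrt (x - y))%:E)}.
Proof.
move=> mh h0 ih2; pose mu := @lebesgue_measure R.
pose C (z : R * R) := \1_`[0, 1] z.1 * (h z.2 / Num.sqrt (z.1 - z.2)).
have mk : measurable_fun setT (fun z : R * R => (Num.sqrt (z.1 - z.2))^-1).
  apply: measurable_fun_inv_sqrt; apply: measurable_funB.
    exact: measurable_fst.
  exact: measurable_snd.
have mC : measurable_fun setT C.
  apply: measurable_funM; first exact: measurable_indic_fst.
  apply: measurable_funM => //.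
  exact: (measurableT_comp mh measurable_snd).
have mkx y : measurable_fun setT (fun x : R => (Num.sqrt (x - y))^-1).
  by apply: measurable_fun_inv_sqrt; apply: measurable_funB.
have iC : (mu \x mu)%E.-integrable setT (EFin \o C).
  apply/integrable21ltyP; first exact/measurable_EFinP.
  have E y : (\int[mu]_x `|(EFin \o C) (x, y)| =
      (`|h y| * (2 * Num.sqrt (1 - y)))%:E)%E.
    have [y01|/h0 y0] := boolP (0 < y < 1); last first.
      rewrite y0 normr0 mul0r; apply: integral0_eq => x _.
      by rewrite /C /= y0 mul0r mulr0 normr0.
    transitivity (\int[mu]_x (\1_`[0%R, 1%R] x * (`|h y| * (Num.sqrt (x - y))^-1))%:E)%E.
      apply: eq_integral => x _ /=; congr (_%:E); rewrite /C /= !normrM indicE.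
      by rewrite normr_nat (@ger0_norm _ (_^-1)) ?invr_ge0 ?sqrtr_ge0.
    rewrite integral_indicM; under eq_integral do rewrite EFinM.
    rewrite ge0_integralZl//; last first.
      by apply/measurable_EFinP; exact: measurable_funTS (mkx y).
    rewrite EFinM; congr (_ * _)%E; rewrite -integral_inv_sqrtr//.
    rewrite -(@integral_itv_bndoo _ _ _ _ true false)//.
    by apply/measurable_EFinP; exact: measurable_funTS (mkx y).
  under eq_integral do rewrite E.
  have i1 : mu.-integrable setT (fun y => (\1_`]0, 1[ y)%:E).
    exact: (integrable_indic_itv 0 1 false true).
  have iD := integrableD measurableT ih2 i1.
  have /integrableP[_ iDlt] := iD.
  apply: (le_lt_trans _ iDlt); apply: ge0_le_integral => //.
  - apply/measurable_EFinP; apply: measurable_funM.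
      exact: measurableT_comp.
    apply: measurable_funM => //.
    apply: (measurableT_comp (continuous_measurable_fun (@sqrt_continuous R))).
    by apply: measurable_funB.
  - apply: measurableT_comp => //; exact: measurable_int iD.
  - move=> y _ /=; rewrite lee_fin [leRHS]ger0_norm ?addr_ge0 ?sqr_ge0//.
    have [y01|/h0 ->] := boolP (0 < y < 1); last first.
      by rewrite normr0 mul0r expr0n add0r.
    rewrite indicE mem_setE in_itv/= y01 -[h y ^+ 2]real_normK ?num_real//.
    have s2 : Num.sqrt (1 - y) ^+ 2 = 1 - y by rewrite sqr_sqrtr//; lra.
    have := sqr_ge0 (`|h y| - Num.sqrt (1 - y)); rewrite sqrrB s2 /=; lra.
have := ae_integrable1 iC; apply: filterS => x ix x01.
apply/integrable_mkcond => //.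
apply: (le_integrable _ _ _ ix) => //.
  apply/measurable_restrict => //; apply: measurable_funTS.
  apply/measurable_EFinP; apply: measurable_funM => //.
  by apply: measurable_fun_inv_sqrt; apply: measurable_funB.
move=> y _; rewrite patchE mem_setE in_itv/=; case: ifPn => _; last first.
  by rewrite abse0 lee_fin.
by rewrite /C /= indicE mem_setE in_itv/= x01 mul1r.
Qed.

(** * Folding the period and passing to real components *)

Section reflection.
Variable R : realType.
Notation mu := (@lebesgue_measure R).

Lemma ge0_integral_opp (f : R -> \bar R) : measurable_fun setT f ->
  (forall x, 0 <= f x)%E -> (\int[mu]_x f (- x)%R = \int[mu]_x f x)%E.
Proof.
move=> mf f0.
have mN : measurable_fun setT (-%R : measurableTypeR R -> measurableTypeR R).
  exact: oppr_measurable.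
transitivity (\int[pushforward mu (-%R : measurableTypeR R -> measurableTypeR R)]_y f y)%E.
  by rewrite ge0_integral_pushforward// preimage_setT.
by apply: eq_measure_integral => A mA _; exact: lebesgue_measureN.
Qed.

(** Lebesgue measure is invariant under [x -> - x]. *)
Lemma integrable_opp (f : R -> R) : mu.-integrable setT (EFin \o f) ->
  mu.-integrable setT (EFin \o (fun x => f (- x))) /\
  Rintegral mu setT (fun x => f (- x)) = Rintegral mu setT f.
Proof.
move=> /integrableP[mf flt].
have mfN : measurable_fun setT (EFin \o (fun x => f (- x))).
  have mN : measurable_fun setT (-%R : R -> R) by exact: oppr_measurable.
  exact: (measurableT_comp mf mN).
split.
  apply/integrableP; split=> //.
  rewrite (ge0_integral_opp (f := fun x => `|(f x)%:E|%E))//.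
  exact: measurableT_comp.
congr fine; rewrite [LHS]integralE [RHS]integralE; congr (_ - _)%E.
  have <- := @ge0_integral_opp _ (measurable_funepos mf) (fun x => funepos_ge0 _ x).
  by apply: eq_integral => x _; rewrite !funeposE.
have <- := @ge0_integral_opp _ (measurable_funeneg mf) (fun x => funeneg_ge0 _ x).
by apply: eq_integral => x _; rewrite !funenegE.
Qed.

Lemma integrable_itv_cc (a b : R) (f : R -> R) : mu.-integrable `]a, b[ (EFin \o f) ->
  mu.-integrable `[a, b] (EFin \o f).
Proof.
move=> /integrableP[mf flt].
have mf' : measurable_fun `[a, b] (EFin \o f).
  exact: (emeasurable_fun_itv_cc mf).
apply/integrableP; split=> //; move: flt.
rewrite -(@integral_itv_bndoo _ _ _ _ true false)//.
exact: measurableT_comp.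
Qed.

Lemma integrable_symmetric (a : R) (f : R -> R) : 0 < a ->
  mu.-integrable `]0, a[ (EFin \o f) ->
  mu.-integrable `]0, a[ (EFin \o (fun x => f (- x))) ->
  mu.-integrable `[- a, a] (EFin \o f) /\
  Rintegral mu `[- a, a] f = Rintegral mu `]0, a[ (fun x => f x + f (- x)).
Proof.
move=> a0 i1 i2.
have [] := @integrable_opp ((fun x => f (- x)) \_ `]0, a[).
  rewrite -restrict_EFin; apply: ((integrable_mkcond _ _).1 i2).
  exact: measurable_itv.
have -> : (fun x => ((fun x => f (- x)) \_ `]0, a[) (- x)) = f \_ `]- a, 0[.
  apply/funext => x; rewrite !patchE !mem_setE !in_itv/= opprK.
  by rewrite oppr_gt0 ltrNl andbC.
rewrite -!Rintegral_mkcond -restrict_EFin => i3' E.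
have i3 : mu.-integrable `]- a, 0[ (EFin \o f).
  apply: ((integrable_mkcond _ _).2 i3'); exact: measurable_itv.
move=> {i3'}.
have i4 := integrable_itv_cc i3; have i5 := integrable_itv_cc i1.
have i3' : mu.-integrable `[- a, 0[ (EFin \o f).
  by apply: integrableS i4 => //; apply: subset_itvl; rewrite bnd_simp.
have U : `[- a, a]%classic = `[- a, 0[%classic `|` `[0, a]%classic :> set R.
  by rewrite -itv_bndbnd_setU// bnd_simp ?oppr_le0 ltW.
have i6 : mu.-integrable `[- a, a] (EFin \o f).
  move: i3' i5 => /integrableP[m3 l3] /integrableP[m5 l5].
  have mU : measurable_fun `[- a, a] (EFin \o f).
    by rewrite U; apply/measurable_funU.
  apply/integrableP; split=> //; rewrite U ge0_integral_setU//=.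
  - exact: lte_add_pinfty.
  - rewrite -U; apply/measurable_EFinP; apply: measurableT_comp => //.
    exact/measurable_EFinP.
  - apply/disj_setPS => x [/=]; rewrite !in_itv/= => /andP[_ x0] /andP[].
    by rewrite leNgt x0.
split=> //.
have := @Rintegral_itvB _ f (BLeft (- a)) (BRight a) 0 i6.
rewrite !bnd_simp => /(_ _ _)/eqP; rewrite oppr_le0 (ltW a0) => /(_ isT isT).
rewrite subr_eq => /eqP ->.
rewrite RintegralD//.
rewrite -E; congr (_ + _).
  by rewrite Rintegral_itv_bndo_bndc.
by rewrite -Rintegral_itv_bndo_bndc// Rintegral_itv_obnd_cbnd.
Qed.

End reflection.

Section abel_real.
Variables (R : realType) (h : R -> R).
Notation mu := (@lebesgue_measure R).
Hypothesis Lh : sq_integrable h.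

(** The real case of the Abel transform, applied below to the real and imaginary
    parts of [f]. *)
Definition abel_real (x : R) : R :=
  Rintegral mu `]0, x[ (fun y => h y / Num.sqrt (x - y)).

Let H : R -> R := h \_ `]0, 1[.

Let HE y : 0 < y < 1 -> H y = h y.
Proof. by move=> y01; rewrite /H patchE mem_setE in_itv/= y01. Qed.

Let mH : measurable_fun setT H.
Proof. by apply/(measurable_restrictT _ _).1 => //; case: Lh. Qed.

Let H0 y : ~~ (0 < y < 1) -> H y = 0.
Proof. by move=> /negbTE y01; rewrite /H patchE mem_setE in_itv/= y01. Qed.

Let iH2 : mu.-integrable setT (fun y => (H y ^+ 2)%:E).
Proof.
have [_ ih] := Lh.
have -> : (fun y => (H y ^+ 2)%:E) = (fun y => (h y ^+ 2)%:E) \_ `]0, 1[.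
  apply/funext => y; rewrite /H !patchE; case: ifPn => // _.
  by rewrite expr0n.
by apply: ((integrable_mkcond _ _).1 ih); exact: measurable_itv.
Qed.

Let abel_realE x : x <= 1 -> abel_real x =
  Rintegral mu `]0, x[ (fun y => H y / Num.sqrt (x - y)).
Proof.
move=> x1; apply: eq_Rintegral => y; rewrite mem_setE in_itv/= => /andP[y0 yx].
by rewrite HE// y0 (lt_le_trans yx).
Qed.

Lemma ae_integrable_abel_real : {ae mu, forall x : R, 0 <= x <= 1 ->
  mu.-integrable `]0, x[ (EFin \o (fun y => h y / Num.sqrt (x - y)))}.
Proof.
have := ae_integrable_abel mH H0 iH2.
apply: filterS; first exact: (ae_filter_ringOfSetsType mu).
move=> x Hx x01; have := Hx x01; apply: eq_integrable => //.
move=> y; rewrite mem_setE in_itv/= => /andP[y0 yx].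
by rewrite /= HE// y0 (lt_le_trans yx)//; case/andP: x01.
Qed.

Let sin_half_le1 (t : R) : 0 < t < pi -> sin (t / 2) ^+ 2 <= 1.
Proof.
move=> t0; have st : 0 <= sin (t / 2) by apply: sin_ge0_pi; lra.
by rewrite expr_le1// sin_le1.
Qed.

Let abel_at_sin2_real t : 0 < t < pi -> abel_at_sin2 H t = abel_real (sin (t / 2) ^+ 2).
Proof. by move=> t0; rewrite abel_at_sin2E// abel_realE// sin_half_le1. Qed.

Lemma integrable_bounded_abel_real (phi : R -> R) : measurable_fun setT phi ->
  (forall t, `|phi t| <= 1) ->
  mu.-integrable `]0, pi[ (EFin \o (fun t => phi t * abel_real (sin (t / 2) ^+ 2))).
Proof.
move=> mphi phi1.
have iT := integrable_bounded_abel_at_sin2 mH H0 iH2 mphi phi1.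
have : mu.-integrable `]0, pi[ (fun t => (phi t * abel_at_sin2 H t)%:E).
  by apply: integrableS iT.
apply: eq_integrable => //.
by move=> t; rewrite mem_setE in_itv/= => t0; rewrite /= abel_at_sin2_real.
Qed.

Lemma Rintegral_sin_abel_real (n : nat) :
  Rintegral mu `]0, pi[ (fun t => sin ((n%:R + 2^-1) * t) * abel_real (sin (t / 2) ^+ 2)) =
  (- 1) ^+ n * pi * Rintegral mu `]0, 1[ (fun y => h y * (slegendre R n).[y]).
Proof.
have msin : measurable_fun setT (fun t : R => sin ((n%:R + 2^-1) * t)).
  exact: measurable_sinM.
(* The restriction to [0 < t < pi] is moved into the bounded factor. *)
pose phi (t : R) : R := \1_`]0, pi[ t * sin ((n%:R + 2^-1) * t).
have mphi : measurable_fun setT phi.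
  by apply: measurable_funM => //; exact: measurable_indic.
have phi1 t : `|phi t| <= 1.
  rewrite normrM indicE normr_nat.
  by case: (_ \in _); rewrite ?mul1r ?mul0r// sin_max.
have := @Rintegral_abel_at_sin2 _ _ mH H0 iH2 phi (fun y => pi * (slegendre R n).[1 - y]) mphi phi1.
have ephi y : {in `]0, pi[%classic, (fun t =>
    (sin ((n%:R + 2^-1) * t) / Num.sqrt (sin (t / 2) ^+ 2 - y))%:E) =1
    (fun t => (phi t / Num.sqrt (sin (t / 2) ^+ 2 - y))%:E)}.
  by move=> t t0; rewrite /phi indicE t0 mul1r.
move=> /(_ _ _)/wrap[].
- move=> y y01; have := integrable_sin_abel_kernel n y01.
  by apply: eq_integrable => //; exact: ephi.
- move=> y y01; rewrite -(integral_sin_abel_kernel n y01).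
  by apply/esym; apply: eq_integral => t; exact: ephi.
move=> E.
transitivity (Rintegral mu setT (fun t => phi t * abel_at_sin2 H t)).
  rewrite [LHS]Rintegral_mkcond; apply: eq_Rintegral => t _.
  rewrite patchE mem_setE /phi indicE mem_setE in_itv/=.
  by case: (boolP (0 < t < pi)) => [t0|_]; rewrite ?mul0r// mul1r abel_at_sin2_real.
have iR := integrable_mul Lh (sq_integrable_horner (slegendre R n)).
rewrite E -(@RintegralZl _ _ _ _ _ _ _ _ iR)//.
apply: eq_Rintegral => y; rewrite mem_setE in_itv/= => y01.
by rewrite HE// slegendre_sym; ring.
Qed.

End abel_real.

Local Open Scope complex_scope.

Section complex_components.
Variable R : realType.
Implicit Types (z w : R[i]) (r : R).

Lemma Re_mulr z r : complex.Re (z * r%:C) = complex.Re z * r.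
Proof. by case: z => a b; rewrite /= mulr0 subr0. Qed.

Lemma Im_mulr z r : complex.Im (z * r%:C) = complex.Im z * r.
Proof. by case: z => a b; rewrite /= mulr0 add0r mulrC. Qed.

Lemma Re_divr z r : complex.Re (z / r%:C) = complex.Re z / r.
Proof. by rewrite -fmorphV Re_mulr. Qed.

Lemma Im_divr z r : complex.Im (z / r%:C) = complex.Im z / r.
Proof. by rewrite -fmorphV Im_mulr. Qed.

Lemma Re_sum (I : Type) (s : seq I) (F : I -> R[i]) :
  complex.Re (\sum_(i <- s) F i) = \sum_(i <- s) complex.Re (F i).
Proof.
by apply: (big_morph (@complex.Re R)) => [[a b] [c d]|].
Qed.

Lemma Im_sum (I : Type) (s : seq I) (F : I -> R[i]) :
  complex.Im (\sum_(i <- s) F i) = \sum_(i <- s) complex.Im (F i).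
Proof.
by apply: (big_morph (@complex.Im R)) => [[a b] [c d]|].
Qed.

Lemma ReB z w : complex.Re (z - w) = complex.Re z - complex.Re w.
Proof. by case: z w => [a b] [c d]. Qed.

Lemma ImB z w : complex.Im (z - w) = complex.Im z - complex.Im w.
Proof. by case: z w => [a b] [c d]. Qed.

Lemma complex_eq z w : complex.Re z = complex.Re w -> complex.Im z = complex.Im w -> z = w.
Proof. by case: z w => [a b] [c d] /= -> ->. Qed.

(** Division by [2 pi i] exchanges the real and imaginary parts, so that the sine
    pairs with a component of [g] and the cosine with the other one; only the
    former survives when the values at [t] and [- t] are added. *)
Lemma eta_expi_components (s b a : R) (g : R[i]) :
  let z := s%:C / ((2 * pi)%:C * (0 +i* 1)) * expi a * g * expi b in
  complex.Re z = s / (2 * pi) * (sin (a + b) * complex.Re g + cos (a + b) * complex.Im g) /\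
  complex.Im z = s / (2 * pi) * (sin (a + b) * complex.Im g - cos (a + b) * complex.Re g).
Proof.
move=> z; case: g @z => g1 g2 z.
have p0 : 2 * pi != 0 :> R by rewrite mulf_neq0// gt_eqF// pi_gt0.
rewrite {}/z; move: p0; generalize (2 * pi : R) => P p0.
have K : (P%:C * (0 +i* 1) : R[i])^-1 = 0 -i* P^-1.
  have k0 : (P%:C * (0 +i* 1) : R[i]) != 0.
    by rewrite eq_complex /= !(mul0r, mulr0, subr0, mulr1, addr0) negb_and p0 orbT.
  by apply: (mulfI k0); rewrite divff//; apply: complex_eq => /=; field.
rewrite K /expi /= sinD cosD.
by split; ring.
Qed.

End complex_components.

Section main.
Variables (R : realType) (f : R -> R[i]).
Notation mu := (@lebesgue_measure R).
Let fr x := complex.Re (f x).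
Let fi x := complex.Im (f x).

Lemma inL2_components : inL2 f -> sq_integrable fr /\ sq_integrable fi.
Proof.
move=> [mr mi fin]; have mfr : measurable_fun (`]0, 1[%classic : set R) fr by [].
have mfi : measurable_fun (`]0, 1[%classic : set R) fi by [].
have i2 : mu.-integrable `]0, 1[ (EFin \o (fun x => fr x ^+ 2 + fi x ^+ 2)).
  apply/integrableP; split.
    by apply/measurable_EFinP; apply: measurable_funD; exact: measurable_funX.
  move: fin; rewrite /sqnormL2; congr (_ < _)%E; apply: eq_integral => x _ /=.
  by rewrite ger0_norm// addr_ge0 ?sqr_ge0.
split; split => //; apply: (le_integrable _ _ _ i2) => //.
- by apply/measurable_EFinP; exact: measurable_funX.
- move=> x _ /=; rewrite lee_fin [leLHS]ger0_norm ?sqr_ge0// [leRHS]ger0_norm ?lerDl ?sqr_ge0//.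
  by rewrite addr_ge0 ?sqr_ge0.
- by apply/measurable_EFinP; exact: measurable_funX.
- move=> x _ /=; rewrite lee_fin [leLHS]ger0_norm ?sqr_ge0// [leRHS]ger0_norm ?lerDr ?sqr_ge0//.
  by rewrite addr_ge0 ?sqr_ge0.
Qed.

Lemma abel_components x : abel f x = abel_real fr x +i* abel_real fi x.
Proof.
by apply: complex_eq; apply: eq_Rintegral => y _; rewrite ?Re_divr ?Im_divr.
Qed.

Lemma legendre_coef_components (P : nat -> {poly R}) (n : nat) : is_legendre P ->
  legendre_coef P f n = fourier_legendre fr n +i* fourier_legendre fi n.
Proof.
move=> HP; have E x : shifted_legendre P n x = (legendre_basis R n).[x].
  by rewrite /shifted_legendre /legendre_basis hornerZ is_legendreE// natrD natrM.
by apply: complex_eq; apply: eq_Rintegral => y _; rewrite ?Re_mulr ?Im_mulr E.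
Qed.

Variable eta : R -> R[i].
Hypothesis eta_def : forall t : R, - pi <= t < pi ->
  eta t = (Num.sg t)%:C / ((2 * pi)%:C * (0 +i* 1))
          * expi (t / 2) * abel f (sin (t / 2) ^+ 2).
Hypothesis Lf : inL2 f.

Let Lfr : sq_integrable fr. Proof. by have [] := inL2_components Lf. Qed.
Let Lfi : sq_integrable fi. Proof. by have [] := inL2_components Lf. Qed.

Let Ar t := abel_real fr (sin (t / 2) ^+ 2).
Let Ai t := abel_real fi (sin (t / 2) ^+ 2).
Let s n t : R := sin ((n%:R + 2^-1) * t).
Let c n t : R := cos ((n%:R + 2^-1) * t).

Let AN t : Ar (- t) = Ar t /\ Ai (- t) = Ai t.
Proof. by rewrite /Ar /Ai mulNr sinN sqrrN. Qed.

Let etaE n t : - pi <= t < pi ->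
  complex.Re (eta t * expi (n%:R * t)) = Num.sg t / (2 * pi) * (s n t * Ar t + c n t * Ai t) /\
  complex.Im (eta t * expi (n%:R * t)) = Num.sg t / (2 * pi) * (s n t * Ai t - c n t * Ar t).
Proof.
move=> tpi; rewrite eta_def// abel_components.
have [-> ->] := eta_expi_components (Num.sg t) (n%:R * t) (t / 2)
   (abel_real fr (sin (t / 2) ^+ 2) +i* abel_real fi (sin (t / 2) ^+ 2)).
rewrite /= /s /c (_ : t / 2 + n%:R * t = (n%:R + 2^-1) * t); last by ring.
by [].
Qed.

Let ms n : measurable_fun setT (s n).
Proof. exact: measurable_sinM. Qed.

Let mc n : measurable_fun setT (c n).
Proof. exact: measurable_cosM. Qed.

Let half_integrable (k a b : R) (phi psi u v : R -> R) :
  (forall t, `|phi t| <= 1) -> (forall t, `|psi t| <= 1) ->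
  measurable_fun setT phi -> measurable_fun setT psi ->
  sq_integrable u -> sq_integrable v ->
  mu.-integrable `]0, pi[ (EFin \o (fun t => k * (a * (phi t * abel_real u (sin (t / 2) ^+ 2)) +
    b * (psi t * abel_real v (sin (t / 2) ^+ 2))))).
Proof.
move=> phi1 psi1 mphi mpsi Lu Lv.
have mD : measurable (`]0, pi[%classic : set (measurableTypeR R)) by exact: measurable_itv.
have i1 := integrableZl mD a (integrable_bounded_abel_real Lu mphi phi1).
have i2 := integrableZl mD b (integrable_bounded_abel_real Lv mpsi psi1).
exact: (integrableZl mD k (integrableD mD i1 i2)).
Qed.

Let pi0 : 0 < pi :> R. Proof. exact: pi_gt0. Qed.

Let FE (n : nat) : {in `]0, pi[%classic,
   (fun t => (complex.Re (eta t * expi (n%:R * t)))%:E) =1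
   (fun t => ((2 * pi)^-1 * (1 * (s n t * Ar t) + 1 * (c n t * Ai t)))%:E)} /\
 {in `]0, pi[%classic,
   (fun t => (complex.Im (eta t * expi (n%:R * t)))%:E) =1
   (fun t => ((2 * pi)^-1 * (1 * (s n t * Ai t) + (-1) * (c n t * Ar t)))%:E)}.
Proof.
have tB (t : R) : 0 < t < pi -> - pi <= t < pi by have := pi0; lra.
by split => t; rewrite mem_setE in_itv/= => t0; congr (_%:E);
  have /andP[t1 _] := t0; have [Er Ei] := etaE n (tB t t0);
  rewrite ?Er ?Ei (gtr0_sg t1); ring.
Qed.

Let FNE (n : nat) : {in `]0, pi[%classic,
   (fun t => (complex.Re (eta (- t) * expi (n%:R * - t)))%:E) =1
   (fun t => ((2 * pi)^-1 * (1 * (s n t * Ar t) + (-1) * (c n t * Ai t)))%:E)} /\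
 {in `]0, pi[%classic,
   (fun t => (complex.Im (eta (- t) * expi (n%:R * - t)))%:E) =1
   (fun t => ((2 * pi)^-1 * (1 * (s n t * Ai t) + 1 * (c n t * Ar t)))%:E)}.
Proof.
have tB (t : R) : 0 < t < pi -> - pi <= - t < pi by have := pi0; lra.
by split => t; rewrite mem_setE in_itv/= => t0; congr (_%:E);
  have /andP[t1 _] := t0; have [Er Ei] := etaE n (tB t t0);
  have [AEr AEi] := AN t; (have sN : Num.sg (- t) = -1 by rewrite ltr0_sg// oppr_lt0);
  rewrite ?Er ?Ei AEr AEi sN /s /c !mulrN sinN cosN; ring.
Qed.

Let gammaE (n : nat) :
  cintegrable `[- pi, pi] (fun t => eta t * expi (n%:R * t)) /\
  gamma_hat eta n = ((- 1) ^+ n * Rintegral mu `]0, 1[ (fun y => fr y * (slegendre R n).[y])) +i*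
    ((- 1) ^+ n * Rintegral mu `]0, 1[ (fun y => fi y * (slegendre R n).[y])).
Proof.
have s1 t : `|s n t| <= 1 by exact: sin_max.
have c1 t : `|c n t| <= 1 by exact: cos_max.
have mD : measurable (`]0, pi[%classic : set (measurableTypeR R)) by exact: measurable_itv.
have P u (w : R -> R) : {in `]0, pi[%classic, (fun t => (w t)%:E) =1 (fun t => (u t)%:E)} ->
    mu.-integrable `]0, pi[ (EFin \o u) -> mu.-integrable `]0, pi[ (EFin \o w).
  by move=> uw; apply: (eq_integrable mD) => t tD /=; rewrite uw.
have [Fr Fi] := FE n; have [Gr Gi] := FNE n.
have Ir := integrable_symmetric pi0
  (P _ _ Fr (half_integrable (2 * pi)^-1 1 1 s1 c1 (ms n) (mc n) Lfr Lfi))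
  (P _ _ Gr (half_integrable (2 * pi)^-1 1 (-1) s1 c1 (ms n) (mc n) Lfr Lfi)).
have Ii := integrable_symmetric pi0
  (P _ _ Fi (half_integrable (2 * pi)^-1 1 (-1) s1 c1 (ms n) (mc n) Lfi Lfr))
  (P _ _ Gi (half_integrable (2 * pi)^-1 1 1 s1 c1 (ms n) (mc n) Lfi Lfr)).
have [{}Ir Er] := Ir; have [{}Ii Ei] := Ii.
split; first by split.
have Q (u : R -> R) (Lu : sq_integrable u) (w1 w2 : R -> R) (k : R -> R) :
    {in `]0, pi[%classic, (fun t => (w1 t)%:E) =1 (fun t => ((2 * pi)^-1 *
      (1 * (s n t * abel_real u (sin (t / 2) ^+ 2)) + 1 * k t))%:E)} ->
    {in `]0, pi[%classic, (fun t => (w2 t)%:E) =1 (fun t => ((2 * pi)^-1 *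
      (1 * (s n t * abel_real u (sin (t / 2) ^+ 2)) + (-1) * k t))%:E)} ->
    Rintegral mu `]0, pi[ (fun t => w1 t + w2 t) =
    (- 1) ^+ n * Rintegral mu `]0, 1[ (fun y => u y * (slegendre R n).[y]).
  move=> E1 E2; transitivity (Rintegral mu `]0, pi[ (fun t =>
    pi^-1 * (s n t * abel_real u (sin (t / 2) ^+ 2)))).
    apply: eq_Rintegral => t tD; have [->] := E1 t tD; have [->] := E2 t tD.
    by move: (lt0r_neq0 pi0); generalize (pi : R) => p p0; field.
  rewrite (@RintegralZl _ _ _ _ _ _ _ mD (integrable_bounded_abel_real Lu (ms n) s1)).
  rewrite Rintegral_sin_abel_real//.
  by rewrite mulrA mulrCA mulVf ?mulr1// gt_eqF.
apply: complex_eq => /=.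
  by rewrite [LHS]Er; exact: (Q _ Lfr _ _ _ Fr Gr).
rewrite [LHS]Ei -(Q _ Lfi _ _ _ Gi Fi).
by apply: eq_Rintegral => t _; rewrite addrC.
Qed.

Lemma cintegrable_eta n : cintegrable `[- pi, pi] (fun t => eta t * expi (n%:R * t)).
Proof. by have [] := gammaE n. Qed.

Lemma gamma_hatE (P : nat -> {poly R}) n : is_legendre P ->
  gamma_hat eta n = (- 1) ^+ n / (Num.sqrt (2 * n + 1)%N%:R)%:C * legendre_coef P f n.
Proof.
move=> HP; have [_ ->] := gammaE n; rewrite legendre_coef_components//.
pose r : R := Num.sqrt (2 * n%:R + 1).
have r0 : r != 0 by rewrite gt_eqF// sqrtr_gt0 ltr_wpDl// mulr_ge0.
have FL (u : R -> R) : sq_integrable u -> fourier_legendre u n =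
    r * Rintegral mu `]0, 1[ (fun y => u y * (slegendre R n).[y]).
  move=> Lu; have iR := integrable_mul Lu (sq_integrable_horner (slegendre R n)).
  rewrite -(@RintegralZl _ _ _ _ _ _ _ _ iR)//.
  by apply: eq_Rintegral => y _; rewrite hornerZ mulrCA.
rewrite !FL// natrD natrM -/r.
have -> : ((- 1) ^+ n : R[i]) = ((- 1) ^+ n)%:C by rewrite rmorphXn rmorphN1.
rewrite -fmorphV -rmorphM mulrC.
by apply: complex_eq; rewrite ?Re_mulr ?Im_mulr /=; field.
Qed.

End main.

(** The squared complex norm is the sum of the squared norms of the two real
    remainders. *)
Lemma cvgL2_legendre (R : realType) (f : R -> R[i]) (P : nat -> {poly R}) :
  is_legendre P -> inL2 f ->
  cvgL2 (fun N x => \sum_(0 <= n < N)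
    legendre_coef P f n * (shifted_legendre P n x)%:C) f.
Proof.
move=> HP Lf; have [Lfr Lfi] := inL2_components Lf.
rewrite /cvgL2.
have E N : sqnormL2 (fun x => f x - \sum_(0 <= n < N)
      legendre_coef P f n * (shifted_legendre P n x)%:C) =
    (sqint (fun x => complex.Re (f x) - (legendre_sum (fun x => complex.Re (f x)) N).[x])%R +
     sqint (fun x => complex.Im (f x) - (legendre_sum (fun x => complex.Im (f x)) N).[x])%R)%E.
  have [mr _] := sq_integrableB Lfr (sq_integrable_horner
    (legendre_sum (fun x => complex.Re (f x)) N)).
  have [mi _] := sq_integrableB Lfi (sq_integrable_horner
    (legendre_sum (fun x => complex.Im (f x)) N)).
  rewrite /sqint -ge0_integralD//; last 4 first.
  - by move=> x _; rewrite lee_fin sqr_ge0.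
  - exact: measurable_sq.
  - by move=> x _; rewrite lee_fin sqr_ge0.
  - exact: measurable_sq.
  apply: eq_integral => x _; rewrite -EFinD; congr (_%:E).
  have sE n : shifted_legendre P n x = (legendre_basis R n).[x].
    by rewrite /shifted_legendre /legendre_basis hornerZ is_legendreE// natrD natrM.
  rewrite ReB ImB Re_sum Im_sum /legendre_sum !horner_sum.
  congr ((_ - _) ^+ 2 + (_ - _) ^+ 2); apply: eq_bigr => n _;
    by rewrite ?Re_mulr ?Im_mulr hornerZ legendre_coef_components// sE.
under eq_fun do rewrite E.
have := cvgeD _ (legendre_sum_cvg Lfr) (legendre_sum_cvg Lfi).
by rewrite adde0; exact.
Qed.

Unset Implicit Arguments.

Theorem theorem1 (R : realType) (P : nat -> {poly R}) (HP : is_legendre P)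
    (f : R -> R[i]) (Hf : inL2 f)
    (eta : R -> R[i])
    (eta_periodic : forall t : R, eta (t + 2 * pi) = eta t)
    (eta_def : forall t : R, - pi <= t < pi ->
       eta t = (Num.sg t)%:C / ((2 * pi)%:C * (0 +i* 1))
               * expi (t / 2) * abel f (sin (t / 2) ^+ 2)) :
  [/\ {ae @lebesgue_measure R, forall x : R, 0 <= x <= 1 ->
        cintegrable `]0, x[ (abel_integrand f x)},
      forall n : nat,
        cintegrable `[- pi, pi] (fun t => eta t * expi (n%:R * t)),
      cvgL2 (fun N x => \sum_(0 <= n < N)
               ((- 1) ^+ n * (Num.sqrt (2 * n + 1)%N%:R)%:C * gamma_hat eta n)
               * (shifted_legendre P n x)%:C) f &
      forall n : nat,
        (- 1) ^+ n / (Num.sqrt (2 * n + 1)%N%:R)%:C * legendre_coef P f n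
        = gamma_hat eta n].
Proof.
have [Lfr Lfi] := inL2_components Hf.
have G n := gamma_hatE eta_def Hf n HP.
split.
- have Ar := ae_integrable_abel_real Lfr.
  have Ai := ae_integrable_abel_real Lfi.
  have F : Filter (almost_everywhere (@lebesgue_measure R)) by exact: ae_filter_ringOfSetsType.
  apply: filterS2 Ar Ai => x Hr Hi x01; split.
    by have := Hr x01; congr (integrable _ _ _); apply/funext => y /=; rewrite Re_divr.
  by have := Hi x01; congr (integrable _ _ _); apply/funext => y /=; rewrite Im_divr.
- by move=> n; exact: (cintegrable_eta eta_def Hf n).
- have H := cvgL2_legendre HP Hf; move: H.
  suff -> : (fun (N : nat) (x : R) => \sum_(0 <= n < N)
    legendre_coef P f n * (shifted_legendre P n x)%:C) =
   (fun (N : nat) (x : R) => \sum_(0 <= n < N)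
               ((- 1) ^+ n * (Num.sqrt (2 * n + 1)%N%:R)%:C * gamma_hat eta n)
               * (shifted_legendre P n x)%:C) by [].
  apply/funext => N; apply/funext => x; apply: eq_bigr => n _; congr (_ * _).
  set r : R := Num.sqrt _.
  have r0 : r%:C != 0.
    rewrite eq_complex /= eqxx andbT gt_eqF// sqrtr_gt0 ltr0n.
    by rewrite addn1.
  rewrite G -/r; set L := legendre_coef P f n.
  transitivity (((- 1) ^+ n) ^+ 2 * (r%:C / r%:C) * L); last by ring.
  by rewrite sqrr_sign mulfV// !mul1r.
- by move=> n; rewrite G.
Qed.
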